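(* Let $N$ be a positive integer, let $Y=(y_1,\dots,y_N)\in\mathbb{Z}^N$ with $y_1<\cdots<y_N$, let $x\in\mathbb{Z}$ and $t\ge 0$. Consider the TASEP with second class particles started from the state $(Y,21\cdots1)$ (so the leftmost particle is the only first class particle and the other $N-1$ particles are second class), and let $E_t$ be the event that at time $t$ the species word is $21\cdots 1$ and the leftmost particle is at $x$, i.e. $E_t=\{(X,21\cdots1;t)\colon x_1=x\}$. Let $C$ be a counterclockwise circle centered at the origin with radius less than $1$. Then $$\mathbb{P}_{(Y,21\cdots 1)}(E_t)=\Big(\frac{1}{2\pi i}\Big)^N\oint_C\cdots\oint_C(1-\xi_1)\prod_{1\le i<j\le N}\frac{\xi_j-\xi_i}{1-\xi_i}\ \prod_{i=1}^N\frac{1}{1-\xi_i}\ \prod_{i=1}^N\Big(\xi_i^{x-y_i-1}e^{\varepsilon(\xi_i)t}\Big)\,d\xi_1\cdots d\xi_N,$$ where $\varepsilon(\xi_i)=1/\xi_i-1$.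
   Context: The TASEP with second class particles (with $N$ particles) is the continuous-time Markov process defined as follows. Each site of $\mathbb{Z}$ is occupied by at most one particle and each particle belongs to species $1$ or species $2$. Particles of species $1$ are called second class particles and particles of species $2$ are called first class particles. Each particle, located at $z$ say, tries to jump to $z+1$ after an exponentially distributed waiting time of rate $1$ (independently for all particles). If $z+1$ is empty, the particle jumps to $z+1$. If $z+1$ is occupied by a particle of the same species, the jump is forbidden and the waiting time is reset. If the particle at $z$ is of species $2$ and $z+1$ is occupied by a particle of species $1$, the two particles interchange positions. If the particle at $z$ is of species $1$ and $z+1$ is occupied by a particle of species $2$, the jump is forbidden and the waiting time is reset. A state is a pair $(X,\pi)$ with $X=(x_1,\dots,x_N)\in\mathbb{Z}^N$, $x_1<\cdots<x_N$, and $\pi=\pi_1\cdots\pi_N$ a word in $\{1,2\}$; it means that the $i$-th particle from the left is at $x_i$ and is of species $\pi_i$. The notation $(X,\pi;t)$ means the state at time $t$ is $(X,\pi)$. $\mathbb{P}_{(Y,\nu)}$ is the probability measure of the process with initial state $(Y,\nu)$. *)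

(* Defs.v *)
From HB Require Import structures.
From mathcomp Require Import all_boot all_order all_algebra all_fingroup.
From mathcomp Require Import all_classical all_reals all_analysis.
From mathcomp Require Import zify.
From mathcomp.real_closed Require Export complex.

Set Implicit Arguments.
Unset Strict Implicit.
Unset Printing Implicit Defensive.

Import Order.TTheory GRing.Theory Num.Theory.
Import numFieldNormedType.Exports.

Local Open Scope classical_set_scope.
Local Open Scope ring_scope.
Local Open Scope complex_scope.

(* A raw state is a pair (X, pi): the i-th particle from the left sits at X i
   and is of species pi i. Species 2 is first class, species 1 second class. *)
Definition raw_state (N : nat) : Type :=
  ({ffun 'I_N -> int} * {ffun 'I_N -> nat})%type.

Definition is_state (N : nat) (s : raw_state N) : bool :=
  [forall i : 'I_N, [forall j : 'I_N, (i < j)%N ==> (s.1 i < s.1 j)]] &&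
  [forall i : 'I_N, (s.2 i == 1%N) || (s.2 i == 2%N)].

Definition state (N : nat) : Type := {s : raw_state N | is_state s}.

(* Effect of an attempted jump of the i-th particle from the left. When two
   particles interchange positions, the set of occupied sites is unchanged and
   only the two letters of the word are swapped. *)
Definition raw_jump (N : nat) (s : raw_state N) (i : 'I_N) : raw_state N :=
  let: (X, nu) := s in
  if [pick j | X j == X i + 1] is Some j then
    if (nu i == 2%N) && (nu j == 1%N)
    then (X, [ffun k => nu (tperm i j k)])
    else (X, nu)
  else ([ffun k => if k == i then X i + 1 else X k], nu).

Lemma raw_jump_is_state (N : nat) (s : state N) (i : 'I_N) :
  is_state (raw_jump (val s) i).
Proof.
case: s => -[X nu] /= sP; move: (sP) => /andP[/= /forallP Xlt /forallP nu12].
case: pickP => [j _|Xi1].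
  case: ifP => // _; apply/andP; split; first exact/forallP.
  by apply/forallP => k; rewrite /= ffunE; exact: nu12.
apply/andP; split; last exact/forallP.
apply/forallP => a; apply/forallP => b; apply/implyP => ab; rewrite /= !ffunE.
have Xab (c e : 'I_N) : (c < e)%N -> X c < X e.
  by have /forallP/(_ e)/implyP := Xlt c.
case: (a =P i) (b =P i) => [ai|_] [bi|_].
- by move: ab; rewrite ai bi ltnn.
- subst a; have /eqP Xb : X b != X i + 1 by rewrite Xi1.
  have := Xab _ _ ab; lia.
- by subst b; have := Xab _ _ ab; lia.
- exact: Xab.
Qed.

Definition jump (N : nat) (s : state N) (i : 'I_N) : state N :=
  Sub (raw_jump (val s) i) (raw_jump_is_state s i).

(* Each of the N independent rate 1 clocks contributes (f (jump s i) - f s) to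
   the generator. Hence, for s != s', tasep_rate s s' is the number of particles
   whose attempted jump leads from s to s', and tasep_rate s s is minus the
   number of particles whose jump is not forbidden. *)
Definition tasep_rate (R : realType) (N : nat) (s s' : state N) : R :=
  \sum_(i < N) ((jump s i == s')%:R - (s == s')%:R).

Record is_transition_function (R : realType) (S : countType)
    (q : S -> S -> R) (p : R -> S -> S -> R) : Prop := {
  transition_ge0 : forall t s s', 0 <= t -> 0 <= p t s s';
  transition_sum1 : forall t s, 0 <= t ->
    \esum_(s' in [set: S]) (p t s s')%:E = 1%E;
  transition0 : forall s s', p 0 s s' = (s == s')%:R;
  transitionD : forall t u s s', 0 <= t -> 0 <= u ->
    (p (t + u) s s')%:E = \esum_(v in [set: S]) (p t s v * p u v s')%:E;
  transition_rate : forall s s',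
    (h^-1 * (p h s s' - (s == s')%:R)) @[h --> 0^'+] --> q s s'
}.

(* In [markov_property], [past] lists finitely many pairs (u, a), read as the
   events Z_u = a, with u <= t. *)
Record is_markov_process (d : measure_display) (T : measurableType d)
    (R : realType) (P : probability T R) (S : countType)
    (p : R -> S -> S -> R) (Z : R -> T -> S) : Prop := {
  markov_measurable : forall t s, 0 <= t -> measurable [set w | Z t w = s];
  markov_property : forall (past : seq (R * S)) t h s s', 0 <= t -> 0 <= h ->
    (forall a, a \in past -> 0 <= a.1 <= t) ->
    P [set w | [/\ forall a, a \in past -> Z a.1 w = a.2,
                   Z t w = s & Z (t + h) w = s']] =
    (P [set w | (forall a, a \in past -> Z a.1 w = a.2) /\ Z t w = s]
      * (p h s s')%:E)%E
}.

Definition is_tasep (d : measure_display) (T : measurableType d)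
    (R : realType) (P : probability T R) (N : nat)
    (Y : {ffun 'I_N -> int}) (nu : {ffun 'I_N -> nat})
    (Z : R -> T -> state N) : Prop :=
  exists p : R -> state N -> state N -> R,
    [/\ is_transition_function (@tasep_rate R N) p,
        is_markov_process P p Z &
        P [set w | val (Z 0 w) = (Y, nu)] = 1%E].

Definition word21 (N : nat) : {ffun 'I_N -> nat} :=
  [ffun i : 'I_N => if val i == 0%N then 2%N else 1%N].

Definition cexp (R : realType) (z : R[i]) : R[i] :=
  (expR (complex.Re z))%:C * (cos (complex.Im z) +i* sin (complex.Im z)).

Definition cintegral (R : realType) (a b : R) (f : R -> R[i]) : R[i] :=
  Rintegral lebesgue_measure `[a, b] (fun x => complex.Re (f x)) +i*
  Rintegral lebesgue_measure `[a, b] (fun x => complex.Im (f x)).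

(* Counterclockwise circle of radius r centered at 0, parametrized by
   r e^(i theta) with 0 <= theta <= 2 pi. *)
Definition circle_integral (R : realType) (r : R) (f : R[i] -> R[i]) : R[i] :=
  cintegral 0 (2 * pi) (fun theta =>
    let z := r%:C * cexp (0 +i* theta) in f z * ((0 +i* 1) * z)).

Fixpoint iter_circle_integral (R : realType) (r : R) (N : nat) :
    (N.-tuple R[i] -> R[i]) -> R[i] :=
  match N return (N.-tuple R[i] -> R[i]) -> R[i] with
  | 0 => fun f => f [tuple]
  | n.+1 => fun f => circle_integral r (fun z =>
      iter_circle_integral r (fun zs : n.-tuple R[i] => f [tuple of z :: zs]))
  end.

Definition epsilon (R : realType) (z : R[i]) : R[i] := z^-1 - 1.

(* Main.v *)
Require Import Defs.
From HB Require Import structures.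
From mathcomp Require Import all_boot all_order all_algebra all_fingroup.
From mathcomp Require Import all_classical all_reals all_analysis.
From mathcomp Require Import ring lra zify.

(* The probability of E_t, as a function of the initial state, solves the
   backward Kolmogorov equation on all states. It vanishes once the word is not
   21...1, because such words are never left again; hence on the positions of
   21...1 it satisfies d/dt v(Y) = sum_k (v(Y + e_k) - v(Y)), with the value 0
   when the first particle tries to jump onto the second one, and with
   v(Y + e_k) = v(Y) when particle k > 1 is blocked. Expanding the Vandermonde
   product turns the multiple integral into the determinant of one-variable
   contour integrals F_{a_i}(x - y_i + m, t) ([entry] below), with
     F_a(n, t) = 1/(2 pi i) oint xi^(n-1) (1-xi)^(-a) e^(eps(xi) t) dxi,
   where F_{a+1}(n) - F_{a+1}(n+1) = F_a(n) and d/dt F_a(n) = F_a(n-1) - F_a(n).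
   Thus the determinant solves the same equations (a row relation for each
   boundary condition) and has the same initial value. It grows at most
   geometrically in the y_i, and in that class the solution is unique. *)

Set Implicit Arguments.
Unset Strict Implicit.
Unset Printing Implicit Defensive.

Import Order.TTheory GRing.Theory Num.Theory.
Import numFieldNormedType.Exports.
Local Open Scope classical_set_scope.
Local Open Scope ring_scope.
Local Open Scope complex_scope.

(** * Linear systems and transition functions *)

Lemma nondecreasing_from0 {R : realType} (f df : R -> R) (T : R) :
  {within `[0, T], continuous f} ->
  (forall (t : R), 0 < t < T -> is_derive t 1 f (df t)) ->
  (forall (t : R), 0 < t < T -> 0 <= df t) ->
  forall (t : R), 0 <= t <= T -> f 0 <= f t.
Proof.
move=> cf dff df0 t /andP[]; rewrite le_eqVlt => /predU1P[<- //|t0 tT].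
have dT y : y \in `]0, t[ -> 0 < y < T.
  by rewrite in_itv/= => /andP[-> /lt_le_trans]; apply.
have [||c ct] := @MVT R f df 0 t t0.
- by move=> y /dT yT; exact: dff.
- apply: continuous_subspaceW cf => y /=.
  by rewrite !in_itv/= => /andP[-> /le_trans]; apply.
- by rewrite -subr_ge0 => ->; rewrite subr0; apply: mulr_ge0; [exact/df0/dT|exact: ltW].
Qed.

(** Both [g - f] and [g + f] vanish at 0 and have a nonnegative derivative. *)
Lemma normr_le_derive {R : realType} (f g df dg : R -> R) (T : R) :
  {within `[0, T], continuous f} -> {within `[0, T], continuous g} ->
  (forall (t : R), 0 < t < T -> is_derive t 1 f (df t)) ->
  (forall (t : R), 0 < t < T -> is_derive t 1 g (dg t)) ->
  (forall (t : R), 0 < t < T -> `|df t| <= dg t) ->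
  f 0 = 0 -> g 0 = 0 ->
  forall (t : R), 0 <= t <= T -> `|f t| <= g t.
Proof.
move=> cf cg dff dgg dfg f0 g0 t tT.
have : (g \- f) 0 <= (g \- f) t.
  apply: (@nondecreasing_from0 _ _ (dg \- df) T) => //.
  - by move=> y; apply: continuousB; [exact: cg|exact: cf].
  - by move=> y yT; apply: is_deriveB; [exact: dgg|exact: dff].
  - by move=> y yT /=; rewrite subr_ge0 (le_trans (ler_norm _))// dfg.
have : (g \+ f) 0 <= (g \+ f) t.
  apply: (@nondecreasing_from0 _ _ (dg \+ df) T) => //.
  - by move=> y; apply: continuousD; [exact: cg|exact: cf].
  - by move=> y yT; apply: is_deriveD; [exact: dgg|exact: dff].
  - move=> y yT /=; have := dfg _ yT; rewrite ler_norml => /andP[+ _].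
    by rewrite -subr_ge0 opprK addrC.
rewrite /= f0 g0 addr0 subr0 => ? ?; rewrite ler_norml; apply/andP; split; lra.
Qed.

(* Iterating the integrated equation k times bounds the solution by the k-th
   term of an exponential series, multiplied by the weight W. *)
Lemma linear_system_unique {R : realType} (I : Type) (n : nat)
    (J : I -> 'I_n -> I) (W : I -> R) (c T : R) (w : I -> R -> R) :
  0 <= c ->
  (forall s i, W (J s i) <= c * W s) ->
  (forall s (t : R), 0 <= t <= T -> `|w s t| <= W s) ->
  (forall s, w s 0 = 0) ->
  (forall s, {within `[0, T], continuous (w s)}) ->
  (forall s (t : R), 0 < t < T ->
     is_derive t 1 (w s) (\sum_(i < n) (w (J s i) t - w s t))) ->
  forall s (t : R), 0 <= t <= T -> w s t = 0.
Proof.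
move=> c0 WJ wW w0 cw dw s t tT.
(* Each of the [n] summands of the equation is at most [W (J s i) + W s], hence at most
   [(c + 1) * W s], at the first iteration; the later iterations reuse the same factor. *)
pose L := n%:R * (c + 1).
have L0 : 0 <= L by rewrite mulr_ge0// addr_ge0.
have W0 u : 0 <= W u.
  by case/andP: tT => t0 tT; apply: le_trans (wW u t _) => //; rewrite t0.
have bound k : forall u (y : R), 0 <= y <= T -> `|w u y| <= W u * L ^+ k / k`!%:R * y ^+ k.
  elim: k => [|k IH] u y yT; first by rewrite !expr0 !mulr1 divr1 wW.
  pose C := W u * L ^+ k.+1 / k.+1`!%:R.
  have dC (z : R) : is_derive z 1 (fun y => C * y ^+ k.+1) (C * (k.+1%:R * z ^+ k)).
    have := is_deriveZ C (is_deriveX k.+1 (is_derive_id z 1)).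
    rewrite /GRing.scale/= mulr1; congr is_derive.
    by apply/funext => a; rewrite /= exprfctE.
  apply: (@normr_le_derive _ (w u) (fun y => C * y ^+ k.+1)
     (fun y => \sum_(i < n) (w (J u i) y - w u y))
     (fun y => C * (k.+1%:R * y ^+ k)) T _ _ _ _ _ _ _ y yT) => //.
  - by apply: derivable_within_continuous => z _; exact: ex_derive.
  - move=> z zT; have zT' : 0 <= z <= T.
      by case/andP: zT => /ltW -> /ltW ->.
    have -> : C * (k.+1%:R * z ^+ k) = \sum_(i < n) ((c + 1) * (W u * L ^+ k / k`!%:R * z ^+ k)).
      rewrite sumr_const card_ord -mulr_natl /C exprS factS natrM /L.
      have : k`!%:R != 0 :> R by rewrite pnatr_eq0 -lt0n fact_gt0.
      have : k.+1%:R != 0 :> R by rewrite pnatr_eq0.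
      by move=> ? ?; field; apply/andP; split.
    apply: le_trans (ler_norm_sum _ _ _) _; apply: ler_sum => i _.
    apply: le_trans (ler_normB _ _) _; rewrite mulrDl mul1r lerD ?IH//.
    apply: le_trans (IH _ _ zT') _; rewrite -!mulrA [leRHS]mulrA ler_wpM2r ?WJ//.
    by rewrite !mulr_ge0 ?exprn_ge0 ?invr_ge0 ?ler0n//; case/andP: zT'.
  - by rewrite expr0n mulr0.
apply/eqP; rewrite -normr_le0.
(* The bounds at time [t] are [W s] times the terms of the series of [expR (L * t)], and these tend
   to 0. *)
have cv : (fun k => W s * exp_coeff (L * t) k) @ \oo --> W s * 0.
  by apply: cvgM; [exact: cvg_cst|exact: cvg_exp_coeff].
rewrite mulr0 in cv.
apply: (cvgr_to_ge cv); apply: nearW => k.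
by apply: le_trans (bound k s t tT) _; rewrite /exp_coeff/= (exprMn k L t) !mulrA mulrAC.
Qed.

Lemma mule_esum_le {R : realType} (T : choiceType) (D : set T) (c : R)
    (a : T -> \bar R) : 0 <= c -> (forall x, (0 <= a x)%E) ->
  (c%:E * (\esum_(x in D) a x) <= \esum_(x in D) (c%:E * a x))%E.
Proof.
rewrite le_eqVlt => /predU1P[<-|c0] a0.
  by rewrite mul0e esum_ge0// => x _; rewrite mul0e.
rewrite -lee_pdivlMl//; apply: ge_ereal_sup => /= _ [X [finX XD] <-].
rewrite lee_pdivlMl// ge0_mule_fsumr//; apply: ereal_sup_ubound.
by exists X.
Qed.

(** * From a uniform right derivative to a two-sided derivative *)

Section uniform_right_derivative.
Context {R : realType} (f g : R -> R) (K : R).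
Hypothesis fg : forall e, 0 < e -> exists2 d, 0 < d &
  forall h t : R, 0 < h < d -> 0 <= t -> `|f (h + t) - f t - h * g t| <= e * h.
Hypothesis gK : forall t, 0 <= t -> `|g t| <= K.

(** The expansion with error constant 1, started at the smaller of the two points, adds 1 to the
    bound [K] on the slope. *)
Lemma uniform_right_derivative_lipschitz : exists2 d, 0 < d &
  forall a b : R, 0 <= a -> 0 <= b -> `|a - b| < d ->
    `|f a - f b| <= (K + 1) * `|a - b|.
Proof.
have [d d0 dP] := fg ltr01; exists d => // a b.
wlog ba : a b / b <= a => [H a0 b0 abd|a0 b0].
  have [ba|ba] := leP b a; first exact: H.
  by rewrite distrC [`|a - b|]distrC; apply: H => //; [exact: ltW|rewrite distrC].
move: ba; rewrite le_eqVlt => /predU1P[->|ba]; first by rewrite !subrr normr0 mulr0.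
have ab0 : 0 < a - b by rewrite subr_gt0.
rewrite (gtr0_norm ab0) => abd.
have := dP (a - b) b; rewrite ab0 abd subrK => /(_ isT b0) H.
rewrite -[f a - f b](subrK ((a - b) * g b)) [leRHS]mulrDl addrC.
apply: le_trans (ler_normD _ _) _; apply: lerD => //.
by rewrite normrM (gtr0_norm ab0) mulrC ler_wpM2r ?gK// ltW.
Qed.

Lemma uniform_right_derivative_near t e : 0 <= t -> 0 < e ->
  exists2 d, 0 < d & forall y, 0 <= y -> `|t - y| < d -> `|f t - f y| < e.
Proof.
move=> t0 e0; have [d d0 dP] := uniform_right_derivative_lipschitz.
have K0 : 0 <= K by apply: le_trans (gK t0).
have K1 : 0 < K + 1 by rewrite ltr_wpDl.
exists (Num.min d (e / (K + 1))) => [|y y0]; first by rewrite lt_min d0 divr_gt0.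
rewrite lt_min => /andP[tyd tye]; apply: le_lt_trans (dP _ _ t0 y0 tyd) _.
by rewrite mulrC -ltr_pdivlMr.
Qed.

Lemma uniform_right_derivative_continuous t : 0 < t -> {for t, continuous f}.
Proof.
move=> t0; apply/cvgrPdist_lt => e e0.
have [d d0 dP] := uniform_right_derivative_near (ltW t0) e0.
near=> y; apply: dP; first by apply: ltW; near: y; exact: lt_nbhsr.
by near: y; apply/nbhs_ballP; exists d.
Unshelve. all: by end_near. Qed.

Lemma uniform_right_derivative_within T : {within `[0, T], continuous f}.
Proof.
apply/subspace_continuousP => t /=; rewrite in_itv/= => /andP[t0 tT].
apply/cvgrPdist_lt => e e0.
have [d d0 dP] := uniform_right_derivative_near t0 e0.
rewrite near_withinE; near=> y => /=; rewrite in_itv/= => /andP[y0 _].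
by apply: dP => //; near: y; apply/nbhs_ballP; exists d.
Unshelve. all: by end_near. Qed.

(** For a step [h < 0] the expansion is applied at the base point [h + t] with step [- h], which is
    possible because its error is uniform in the base point. Continuity of [g] then replaces
    [g (h + t)] by [g t]. *)
Lemma uniform_right_derivative_is_derive t : 0 < t -> {for t, continuous g} ->
  is_derive t 1 f (g t).
Proof.
move=> t0 cg.
suff H : h^-1 *: (f (h *: 1 + t) - f t) @[h --> 0^'] --> g t.
  apply: DeriveDef; last exact/cvg_lim.
  by apply/cvg_ex; exists (g t).
apply/cvgrPdist_lt => e e0; have e20 : 0 < e / 2 by rewrite divr_gt0.
have [d d0 dP] := fg e20.
have [d' d'0 gP] : exists2 d', 0 < d' &
    forall y, `|t - y| < d' -> `|g t - g y| < e / 2.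
  by move/cvgrPdist_lt: cg => /(_ _ e20) /nbhs_ballP[d' d'0 gP]; exists d'.
near=> h.
have h0 : h != 0 by near: h; exact: nbhs_dnbhs_neq.
have hd : `|h| < d by near: h; exact: dnbhs0_lt.
have ht : `|h| < t by near: h; exact: dnbhs0_lt.
have hd' : `|h| < d' by near: h; exact: dnbhs0_lt.
rewrite [X in X + t](mulr1 h) /GRing.scale/=.
have nh : 0 < `|h| by rewrite normr_gt0.
rewrite -(ltr_pM2l nh) -normrM mulrBr mulrA divff// mul1r.
have he : `|h| * (e / 2) < `|h| * e by rewrite ltr_pM2l//; lra.
have [hgt|hlt|heq] := ltgtP h 0; last by rewrite heq eqxx in h0.
- have th : 0 <= h + t by move: ht; rewrite ltr0_norm// => ?; lra.
  have gh : `|g t - g (h + t)| < e / 2.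
    by apply: gP; rewrite opprD addrCA subrr addr0 normrN.
  have hN : 0 < - h < d by rewrite oppr_gt0 hgt/= -(ltr0_norm hgt).
  have := dP _ _ hN th; rewrite addKr => H.
  have -> : h * g t - (f (h + t) - f t) =
      (f t - f (h + t) - - h * g (h + t)) + h * (g t - g (h + t)) by ring.
  apply: le_lt_trans (ler_normD _ _) _.
  have -> : `|h| * e = e / 2 * - h + `|h| * (e / 2) by rewrite ltr0_norm//; field.
  by apply: ler_ltD => //; rewrite normrM ltr_pM2l.
- have hP : 0 < h < d by rewrite hlt/= -(gtr0_norm hlt).
  have H := dP _ _ hP (ltW t0).
  rewrite distrC; apply: le_lt_trans H _; rewrite mulrC -{1}(gtr0_norm hlt).
  exact: he.
Unshelve. all: by end_near. Qed.

End uniform_right_derivative.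

(** * The backward equation for a transition function *)

Section transition.
Context {R : realType} {S : countType} (n : nat) (J : S -> 'I_n -> S).
Context (p : R -> S -> S -> R).
Hypothesis pP : is_transition_function
  (fun s s' => \sum_(i < n) ((J s i == s')%:R - (s == s')%:R)) p.

(* The probability of being in [E] at time [t], not of having visited [E]. *)
Definition hit (E : set S) (s : S) (t : R) : R :=
  fine (\esum_(s' in E) (p t s s')%:E)%E.

Implicit Types (E : set S) (s : S) (t h : R).

Lemma hitE E s t : 0 <= t -> (hit E s t)%:E = (\esum_(s' in E) (p t s s')%:E)%E.
Proof.
move=> t0; rewrite /hit fineK// ge0_fin_numE; last first.
  by apply: esum_ge0 => s' _; rewrite lee_fin (transition_ge0 pP).
apply: (@le_lt_trans _ _ 1%E); last exact: ltry.
rewrite -(transition_sum1 pP s t0) esum_mkcond; apply: le_esum => s' _.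
by case: ifP => // _; rewrite lee_fin (transition_ge0 pP).
Qed.

Lemma hit_ge0 E s t : 0 <= t -> 0 <= hit E s t.
Proof.
move=> t0; rewrite -lee_fin hitE//; apply: esum_ge0 => s' _.
by rewrite lee_fin (transition_ge0 pP).
Qed.

Lemma hitC E s t : 0 <= t -> hit E s t + hit (~` E) s t = 1.
Proof.
move=> t0; apply: EFin_inj; rewrite EFinD !hitE// -(transition_sum1 pP s t0).
rewrite [RHS](esumID E) => [|s' _]; last by rewrite lee_fin (transition_ge0 pP).
by rewrite !setTI.
Qed.

Lemma hit_le1 E s t : 0 <= t -> hit E s t <= 1.
Proof. by move=> t0; rewrite -(hitC E s t0) lerDl hit_ge0. Qed.

Lemma hit0 E s : hit E s 0 = (s \in E)%:R.
Proof.
apply: EFin_inj; rewrite hitE// (eq_esum (b := fun s' => (s == s')%:R%:E)); last first.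
  by move=> s' _; rewrite (transition0 pP).
have [sE|sE] := boolP (s \in E).
  rewrite (esumID [set s]) => [|s' _]; last by rewrite lee_fin.
  rewrite setIC setIidl => [|_ ->]; last exact: set_mem.
  rewrite esum_set1 ?eqxx ?lee_fin// esum1 ?adde0// => s' [_ /= /eqP].
  by rewrite eq_sym => /negbTE ->.
rewrite esum1// => s' s'E; have [ss'|//] := eqVneq s s'.
by move: sE; rewrite ss' mem_set.
Qed.

(** This is the Chapman-Kolmogorov equation over a first stretch of length [h], with only the
    intermediate states of the finite list [D] kept. *)
Lemma hit_lower E (D : seq S) s t h : uniq D -> 0 <= t -> 0 <= h ->
  \sum_(u <- D) p h s u * hit E u t <= hit E s (h + t).
Proof.
move=> uD t0 h0; rewrite -lee_fin hitE ?addr_ge0//.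
have p0 a b c : 0 <= a -> (0 <= (p a b c)%:E)%E.
  by move=> a0; rewrite lee_fin (transition_ge0 pP).
apply: (@le_trans _ _ (\esum_(s' in E) \sum_(u <- D) (p h s u * p t u s')%:E)%E).
  rewrite esum_sum; last by move=> i j _ _; rewrite lee_fin mulr_ge0// (transition_ge0 pP).
  rewrite -sumEFin; apply: lee_sum => u _; rewrite EFinM hitE//.
  by apply: mule_esum_le => [|x]; [exact: (transition_ge0 pP)|exact: p0].
apply: le_esum => s' _; rewrite (transitionD pP)//.
rewrite fsbig_seq//; apply: ereal_sup_ubound => /=; exists [set` D] => //.
by rewrite /fsets/=; split.
Qed.

(* [hit_lower] for the complement of [E]. *)
Lemma hit_upper E (D : seq S) s t h : uniq D -> 0 <= t -> 0 <= h ->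
  hit E s (h + t) <= \sum_(u <- D) p h s u * hit E u t + (1 - \sum_(u <- D) p h s u).
Proof.
move=> uD t0 h0; have := hit_lower (~` E) s uD t0 h0.
have hC u a : 0 <= a -> hit (~` E) u a = 1 - hit E u a.
  by move=> a0; rewrite -(hitC E u a0) addrC addKr.
rewrite hC ?addr_ge0// (eq_bigr (fun u => p h s u - p h s u * hit E u t)) => [|u _].
  by rewrite sumrB; lra.
by rewrite hC// mulrBr mulr1.
Qed.

(** The right-hand side of the backward equation: the generator applied to [hit E] as a function of
    the initial state. *)
Definition hit_rate E s t := \sum_(i < n) (hit E (J s i) t - hit E s t).

Lemma hit_rate_le E s t : 0 <= t -> `|hit_rate E s t| <= n%:R.
Proof.
move=> t0; apply: le_trans (ler_norm_sum _ _ _) _.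
rewrite -[in leRHS](card_ord n) -sum1_card natr_sum; apply: ler_sum => i _.
have a := hit_ge0 E s t0; have b := hit_le1 E s t0.
have c := hit_ge0 E (J s i) t0; have d := hit_le1 E (J s i) t0.
by rewrite ler_norml; apply/andP; split; lra.
Qed.

(** The state at time [h] is conditioned on, and [hit_lower] and [hit_upper] bracket the result. The
    error involves the rates from [s] to finitely many states, and it is uniform in [t] because
    [hit] takes values between 0 and 1. *)
Lemma hit_uniform E s e : 0 < e -> exists2 d, 0 < d &
  forall h t : R, 0 < h < d -> 0 <= t ->
    `|hit E s (h + t) - hit E s t - h * hit_rate E s t| <= e * h.
Proof.
move=> e0.
pose q s s' : R := \sum_(i < n) ((J s i == s')%:R - (s == s')%:R).
(* The state [s] and its successors by one jump: outside this list the rates from [s] vanish. *)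
pose D := undup (s :: [seq J s i | i <- enum 'I_n]).
have uD : uniq D by rewrite undup_uniq.
have sumD (f : S -> R) u : u \in D -> \sum_(v <- D) (u == v)%:R * f v = f u.
  move=> uinD; rewrite (bigD1_seq u)//= eqxx mul1r big1 ?addr0// => v.
  by rewrite eq_sym => /negbTE ->; rewrite mul0r.
have sD : s \in D by rewrite mem_undup inE eqxx.
have JD i : J s i \in D.
  by rewrite mem_undup inE (map_f (J s)) ?orbT// mem_enum.
have sumq (f : S -> R) : \sum_(v <- D) q s v * f v = \sum_(i < n) (f (J s i) - f s).
  under eq_bigr do rewrite mulr_suml.
  rewrite exchange_big/=; apply: eq_bigr => i _.
  under eq_bigr do rewrite mulrBl.
  by rewrite sumrB !sumD.
have cvgD : (fun h => \sum_(v <- D) `|q s v - h^-1 * (p h s v - (s == v)%:R)|) @ 0^'+ --> (0 : R).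
  elim: (D) => [|v D' IH].
    by under eq_fun do rewrite big_nil; exact: cvg_cst.
  have H : (fun h => `|q s v - h^-1 * (p h s v - (s == v)%:R)|) @ 0^'+
      --> `|q s v - q s v|.
    by apply: cvg_norm; apply: cvgB; [exact: cvg_cst|exact: (transition_rate pP)].
  rewrite subrr normr0 in H; have {IH}H := cvgD H IH; rewrite addr0 in H.
  rewrite [X in X @ _](_ : _ = (fun h => `|q s v - h^-1 * (p h s v - (s == v)%:R)|)
    \+ fun h => \sum_(v <- D') `|q s v - h^-1 * (p h s v - (s == v)%:R)|); first exact: H.
  by apply/funext => h; rewrite big_cons.
have [d d0 dP] : exists2 d, 0 < d & forall h, 0 < h < d ->
    \sum_(v <- D) `|q s v - h^-1 * (p h s v - (s == v)%:R)| <= e.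
  move/cvgrPdist_lt: cvgD => /(_ _ e0) [d /= d0 dP].
  exists d => // h /andP[h0 hd].
  have := dP h; rewrite /= !sub0r !normrN gtr0_norm// => /(_ hd h0) /ltW.
  exact: le_trans (ler_norm _).
exists d => // h t hd t0.
have h0 : 0 < h by case/andP: hd.
have lo := hit_lower E s uD t0 (ltW h0); have up := hit_upper E s uD t0 (ltW h0).
pose r v := p h s v - (s == v)%:R - h * q s v.
have rE v : p h s v = (s == v)%:R + h * q s v + r v by rewrite /r; ring.
have rsum : \sum_(v <- D) `|r v| <= e * h.
  rewrite mulrC; apply: le_trans (ler_wpM2l (ltW h0) (dP _ hd)).
  rewrite mulr_sumr; apply: ler_sum => v _.
  rewrite -{1}(gtr0_norm h0) -normrM distrC /r mulrBr mulrA divff ?gt_eqF//.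
  by rewrite mul1r.
clearbody r.
have pE (f : S -> R) : \sum_(v <- D) p h s v * f v =
    f s + h * \sum_(i < n) (f (J s i) - f s) + \sum_(v <- D) r v * f v.
  under eq_bigr do rewrite rE !mulrDl -mulrA.
  by rewrite !big_split/= sumD// -mulr_sumr sumq big_split.
(* For the constant function 1 the identity says that [p h s] has mass 1 plus the sum of the [r v]
   on [D]. The mass missing in [hit_upper] is therefore of the order of the error as well. *)
have := pE (fun=> 1); under eq_bigr do rewrite mulr1.
rewrite [X in h * X]big1 => [|i _]; last by rewrite subrr.
rewrite mulr0 addr0; under [in RHS]eq_bigr do rewrite mulr1.
move=> pE1.
move: lo up; rewrite pE1 !pE -/(hit_rate E s t) => lo up.
have rf (f : S -> R) : (forall v, 0 <= f v <= 1) ->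
    `|\sum_(v <- D) r v * f v| <= e * h.
  move=> f01; apply: le_trans (ler_norm_sum _ _ _) (le_trans _ rsum).
  apply: ler_sum => v _; have /andP[f0 f1] := f01 v.
  by rewrite normrM (ger0_norm f0) ler_piMr.
have := rf (fun v => hit E v t); have := rf (fun v => 1 - hit E v t).
have -> : \sum_(v <- D) r v * (1 - hit E v t) =
    \sum_(v <- D) r v - \sum_(v <- D) r v * hit E v t.
  by rewrite -sumrB; apply: eq_bigr => v _; rewrite mulrBr mulr1.
move: lo up.
set X := \sum_(v <- D) r v * _; set Y := \sum_(v <- D) r v.
move=> lo up; rewrite !ler_norml.
have h01 v : 0 <= hit E v t <= 1 by rewrite hit_ge0// hit_le1.
move=> H1 H2.
have /andP[H11 H12] : - (e * h) <= Y - X <= e * h.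
  by apply: H1 => v; have /andP[? ?] := h01 v; apply/andP; split; lra.
have /andP[H21 H22] := H2 h01.
by apply/andP; split; lra.
Qed.

Lemma hit_continuous E s t : 0 < t -> {for t, continuous (hit E s)}.
Proof.
exact: (uniform_right_derivative_continuous (hit_uniform E s) (@hit_rate_le E s)).
Qed.

Lemma hit_within E s T : {within `[0, T], continuous (hit E s)}.
Proof.
exact: (uniform_right_derivative_within (hit_uniform E s) (@hit_rate_le E s)).
Qed.

Lemma hit_is_derive E s t : 0 < t -> is_derive t 1 (hit E s) (hit_rate E s t).
Proof.
move=> t0; apply: (uniform_right_derivative_is_derive (hit_uniform E s) t0).
suff H (r : seq 'I_n) : (fun y => \sum_(i <- r) (hit E (J s i) y - hit E s y)) @ t -->
    \sum_(i <- r) (hit E (J s i) t - hit E s t) by exact: H.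
elim: r => [|i r IH]; first by under eq_fun do rewrite big_nil; rewrite big_nil; exact: cvg_cst.
under eq_fun do rewrite big_cons; rewrite big_cons.
by apply: cvgD IH; apply: cvgB; exact: hit_continuous.
Qed.

End transition.

(** * Complex-valued functions of a real variable *)

Section complex_functions.
Context {R : realType}.
Implicit Types (z w : R[i]) (f g : R -> R[i]) (s t : R).
Local Notation Re := complex.Re.
Local Notation Im := complex.Im.

Lemma cReD z w : Re (z + w) = Re z + Re w. Proof. by case: z; case: w. Qed.
Lemma cImD z w : Im (z + w) = Im z + Im w. Proof. by case: z; case: w. Qed.
Lemma cReN z : Re (- z) = - Re z. Proof. by case: z. Qed.
Lemma cImN z : Im (- z) = - Im z. Proof. by case: z. Qed.
Lemma cReM z w : Re (z * w) = Re z * Re w - Im z * Im w.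
Proof. by case: z; case: w. Qed.
Lemma cImM z w : Im (z * w) = Re z * Im w + Im z * Re w.
Proof. by case: z; case: w. Qed.
Lemma cReV z : Re z^-1 = Re z / (Re z ^+ 2 + Im z ^+ 2).
Proof. by case: z. Qed.
Lemma cImV z : Im z^-1 = - (Im z / (Re z ^+ 2 + Im z ^+ 2)).
Proof. by case: z. Qed.

Lemma complex_ext z w : Re z = Re w -> Im z = Im w -> z = w.
Proof. by case: z => a b; case: w => c e /= -> ->. Qed.

Lemma ler_Re_norm z s : `|z| <= s%:C -> `|Re z| <= s.
Proof.
rewrite normc_def lecR; apply: le_trans; rewrite -sqrtr_sqr ler_wsqrtr//.
by rewrite lerDl sqr_ge0.
Qed.

Lemma ler_Im_norm z s : `|z| <= s%:C -> `|Im z| <= s.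
Proof.
rewrite normc_def lecR; apply: le_trans; rewrite -sqrtr_sqr ler_wsqrtr//.
by rewrite lerDr sqr_ge0.
Qed.

Lemma cexpD z w : cexp (z + w) = cexp z * cexp w.
Proof.
case: z => a b; case: w => c e; rewrite /cexp/= expRD cosD sinD.
by apply: complex_ext; rewrite !(cReM, cImM)/=; ring.
Qed.

Lemma cexp0 : cexp 0 = 1 :> R[i].
Proof. by rewrite /cexp/= expR0 cos0 sin0 mul1r. Qed.

Lemma cexp_neq0 z : cexp z != 0.
Proof.
apply/eqP => z0; have := cexpD z (- z); rewrite subrr cexp0 z0 mul0r.
by move/eqP; rewrite oner_eq0.
Qed.

Lemma norm_cexp z : `|cexp z| = (expR (Re z))%:C.
Proof.
case: z => a b; rewrite /cexp normc_def !(cReM, cImM)/= !mul0r subr0 addr0.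
rewrite !exprMn -mulrDr cos2Dsin2 mulr1 sqrtr_sqr ger0_norm//.
Qed.

Lemma cexpX z (n : nat) : cexp z ^+ n = cexp (z *+ n).
Proof.
by elim: n => [|n IH]; rewrite ?expr0 ?mulr0n ?cexp0// exprS mulrS cexpD IH.
Qed.

Lemma cexpN z : cexp (- z) = (cexp z)^-1.
Proof.
by apply: (mulIf (cexp_neq0 z)); rewrite -cexpD addNr cexp0 mulVf// cexp_neq0.
Qed.

Lemma cexp_expz z (n : int) : cexp z ^ n = cexp (z *~ n).
Proof.
case: n => n; first by rewrite -exprnP cexpX -pmulrn.
by rewrite NegzE -exprnN cexpX mulrNz -pmulrn cexpN.
Qed.

(** Stated on real and imaginary parts, since [cintegral] is built from real integrals of these. *)
Definition ccontinuous f :=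
  continuous (fun x => Re (f x)) /\ continuous (fun x => Im (f x)).

Lemma ccontinuous_cst z : ccontinuous (fun=> z).
Proof. by split; exact: cst_continuous. Qed.

Lemma ccontinuousD f g : ccontinuous f -> ccontinuous g ->
  ccontinuous (fun x => f x + g x).
Proof.
move=> [f1 f2] [g1 g2]; split=> x.
  by under eq_fun do rewrite cReD; apply: cvgD; [exact: f1|exact: g1].
by under eq_fun do rewrite cImD; apply: cvgD; [exact: f2|exact: g2].
Qed.

Lemma ccontinuousN f : ccontinuous f -> ccontinuous (fun x => - f x).
Proof.
move=> [f1 f2]; split=> x.
  by under eq_fun do rewrite cReN; apply: cvgN; exact: f1.
by under eq_fun do rewrite cImN; apply: cvgN; exact: f2.
Qed.

Lemma ccontinuousM f g : ccontinuous f -> ccontinuous g ->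
  ccontinuous (fun x => f x * g x).
Proof.
move=> [f1 f2] [g1 g2]; split=> x.
  under eq_fun do rewrite cReM.
  apply: cvgB; apply: cvgM;
    by [exact: f1|exact: g1|exact: f2|exact: g2].
under eq_fun do rewrite cImM.
apply: cvgD; apply: cvgM;
  by [exact: f1|exact: g1|exact: f2|exact: g2].
Qed.

Lemma ccontinuousV f : (forall x, f x != 0) -> ccontinuous f ->
  ccontinuous (fun x => (f x)^-1).
Proof.
move=> f0 [f1 f2].
have n0 x : Re (f x) ^+ 2 + Im (f x) ^+ 2 != 0.
  rewrite paddr_eq0 ?sqr_ge0// !sqrf_eq0; apply: contra (f0 x) => /andP[/eqP a /eqP b].
  by apply/eqP/complex_ext.
have cn : continuous (fun x => (Re (f x) ^+ 2 + Im (f x) ^+ 2)^-1).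
  move=> x; apply: cvgV => //; apply: cvgD; apply: cvgM;
    by [exact: f1|exact: f2].
split=> x.
  by under eq_fun do rewrite cReV; apply: cvgM; [exact: f1|exact: cn].
under eq_fun do rewrite cImV; apply: cvgN; apply: cvgM; [exact: f2|exact: cn].
Qed.

Lemma ccontinuousX f n : ccontinuous f -> ccontinuous (fun x => f x ^+ n).
Proof.
move=> fc; elim: n => [|n IH]; first exact: ccontinuous_cst.
by under eq_fun do rewrite exprS; exact: ccontinuousM.
Qed.

Lemma ccontinuous_expz f (n : int) : (forall x, f x != 0) -> ccontinuous f ->
  ccontinuous (fun x => f x ^ n).
Proof.
move=> f0 fc; case: n => n; first exact: ccontinuousX.
by apply: ccontinuousV; [move=> x; rewrite expf_neq0|exact: ccontinuousX].
Qed.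

Lemma ccontinuous_cexp f : ccontinuous f -> ccontinuous (fun x => cexp (f x)).
Proof.
move=> [f1 f2]; rewrite /cexp; apply: ccontinuousM; split => x /=.
- by apply: continuous_comp; [exact: f1|exact: continuous_expR].
- exact: cst_continuous.
- by apply: continuous_comp; [exact: f2|exact: continuous_cos].
- by apply: continuous_comp; [exact: f2|exact: continuous_sin].
Qed.

Definition is_cderive t f w :=
  is_derive t 1 (fun x => Re (f x)) (Re w) /\
  is_derive t 1 (fun x => Im (f x)) (Im w).

Lemma is_cderive_cst t z : is_cderive t (fun=> z) 0.
Proof. by split; exact: is_derive_cst. Qed.

Lemma is_cderiveD t f g w z : is_cderive t f w -> is_cderive t g z ->
  is_cderive t (fun x => f x + g x) (w + z).
Proof.
move=> [f1 f2] [g1 g2]; split.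
  by under eq_fun do rewrite cReD; rewrite cReD; exact: is_deriveD.
by under eq_fun do rewrite cImD; rewrite cImD; exact: is_deriveD.
Qed.

Lemma is_cderiveM t f g w z : is_cderive t f w -> is_cderive t g z ->
  is_cderive t (fun x => f x * g x) (w * g t + f t * z).
Proof.
move=> [f1 f2] [g1 g2]; split.
  under eq_fun do rewrite cReM; apply: is_derive_eq.
  by rewrite cReD !cReM /GRing.scale/=; ring.
under eq_fun do rewrite cImM; apply: is_derive_eq.
by rewrite cImD !cImM /GRing.scale/=; ring.
Qed.

Lemma is_cderiveZ t f w z : is_cderive t f w -> is_cderive t (fun x => z * f x) (z * w).
Proof.
by move=> fw; have := is_cderiveM (is_cderive_cst t z) fw; rewrite mul0r add0r.
Qed.

Lemma is_cderive_sum t (I : Type) (r : seq I) (f : I -> R -> R[i]) (w : I -> R[i]) :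
  (forall i, is_cderive t (f i) (w i)) ->
  is_cderive t (fun x => \sum_(i <- r) f i x) (\sum_(i <- r) w i).
Proof.
move=> fw; elim: r => [|i r IH].
  by under eq_fun do rewrite big_nil; rewrite big_nil; exact: is_cderive_cst.
under eq_fun do rewrite big_cons; rewrite big_cons; exact: is_cderiveD.
Qed.

Lemma is_cderive_prod t n (f : 'I_n -> R -> R[i]) (w : 'I_n -> R[i]) :
  (forall i, is_cderive t (f i) (w i)) ->
  is_cderive t (fun x => \prod_(i < n) f i x)
    (\sum_(k < n) \prod_(i < n) (if i == k then w i else f i t)).
Proof.
elim: n => [|n IH] in f w * => fw.
  by under eq_fun do rewrite big_ord0; rewrite big_ord0; exact: is_cderive_cst.
under eq_fun do rewrite big_ord_recl; rewrite big_ord_recl.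
have := is_cderiveM (fw ord0) (IH _ _ (fun i => fw (lift ord0 i))).
congr is_cderive; congr (_ + _).
  by rewrite big_ord_recl.
rewrite mulr_sumr; apply: eq_bigr => k _; rewrite big_ord_recl/=; congr (_ * _).
Qed.

Lemma is_cderive_cexp t z : is_cderive t (fun s => cexp (z * s%:C)) (z * cexp (z * t%:C)).
Proof.
case: z => a b.
have E s : cexp ((a +i* b) * s%:C) = expR (a * s) * cos (b * s) +i* (expR (a * s) * sin (b * s)).
  rewrite /cexp cReM cImM/= !mulr0 subr0 add0r.
  by apply: complex_ext; rewrite !(cReM, cImM)/=; ring.
split; under eq_fun do rewrite E; rewrite E/=.
  apply: is_derive_eq; rewrite /GRing.scale/=; ring.
apply: is_derive_eq; rewrite /GRing.scale/=; ring.
Qed.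

(** * Integrals of complex-valued functions over a segment *)

Local Notation mu := (@lebesgue_measure R).

Lemma continuous_itv_integrable (h : R -> R) s t : continuous h ->
  mu.-integrable `[s, t] (EFin \o h).
Proof.
move=> ch; apply: continuous_compact_integrable; first exact: segment_compact.
exact: continuous_subspaceT.
Qed.

Lemma cintegralD s t f g : ccontinuous f -> ccontinuous g ->
  cintegral s t (fun x => f x + g x) = cintegral s t f + cintegral s t g.
Proof.
move=> [f1 f2] [g1 g2]; apply: complex_ext; rewrite ?(cReD, cImD)/=.
  under eq_Rintegral do rewrite cReD.
  by rewrite RintegralD//; exact: continuous_itv_integrable.
under eq_Rintegral do rewrite cImD.
by rewrite RintegralD//; exact: continuous_itv_integrable.
Qed.

Lemma cintegralZ s t z f : ccontinuous f ->
  cintegral s t (fun x => z * f x) = z * cintegral s t f.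
Proof.
move=> [f1 f2]; apply: complex_ext; rewrite ?(cReM, cImM)/=.
  under eq_Rintegral do rewrite cReM.
  rewrite RintegralB ?RintegralZl//; do ?exact: continuous_itv_integrable.
    apply: continuous_itv_integrable => x; apply: cvgM; [exact: cvg_cst|exact: f1].
  apply: continuous_itv_integrable => x; apply: cvgM; [exact: cvg_cst|exact: f2].
under eq_Rintegral do rewrite cImM.
rewrite RintegralD ?RintegralZl//; do ?exact: continuous_itv_integrable.
  apply: continuous_itv_integrable => x; apply: cvgM; [exact: cvg_cst|exact: f2].
apply: continuous_itv_integrable => x; apply: cvgM; [exact: cvg_cst|exact: f1].
Qed.

Lemma cintegral0 s t : cintegral s t (fun=> 0 : R[i]) = 0.
Proof. by apply: complex_ext; rewrite /= Rintegral_cst// mul0r. Qed.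

Lemma Rintegral_le_bound (h : R -> R) s t M : s <= t -> continuous h ->
  (forall x, `|h x| <= M) -> `|Rintegral mu `[s, t] h| <= M * (t - s).
Proof.
move=> st ch hM.
have H : `|Rintegral mu `[s, t] h| <= Rintegral mu `[s, t] (fun x => `|h x|).
  by apply: le_normr_Rintegral => //; exact: continuous_itv_integrable.
apply: (le_trans H).
have -> : M * (t - s) = Rintegral mu `[s, t] (fun=> M).
  rewrite Rintegral_cst//= lebesgue_measure_itv/= lte_fin.
  by case: ltgtP st => //= ->; rewrite subrr.
apply: le_Rintegral => //.
  by apply: continuous_itv_integrable => x; apply: cvg_norm; exact: ch.
by apply: continuous_itv_integrable; exact: cst_continuous.
Qed.

(** Differentiation under the integral sign by domination: the dominating function is the constant
    [M], on the unit neighbourhood of [a]. *)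
Lemma is_derive_Rintegral (h dh : R -> R -> R) s t (a M : R) :
  (forall u, continuous (h u)) -> (forall u, continuous (dh u)) ->
  (forall u x : R, is_derive u 1 (h ^~ x) (dh u x)) ->
  (forall u x : R, `|u - a| < 1 -> `|dh u x| <= M) ->
  is_derive a 1 (fun u => Rintegral mu `[s, t] (h u)) (Rintegral mu `[s, t] (dh a)).
Proof.
move=> ch cdh dhh dM.
have d1 (u x : R) : partial1of2 h u x = dh u x.
  by rewrite partial1of2E; have [_ ->] := dhh u x.
have aI : `]a - 1, a + 1[%classic a by rewrite /= in_itv/= ltrBlDr ltrDl ltr01.
have uI (u : R) : `]a - 1, a + 1[%classic u -> `|u - a| < 1.
  by rewrite /= in_itv/= => /andP[? ?]; rewrite ltr_norml; apply/andP; split; lra.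
have {d1} d1I : Rintegral mu `[s, t] (dh a) = Rintegral mu `[s, t] (partial1of2 h a).
  by apply: eq_Rintegral => x _; exact: esym (d1 _ _).
suff H : u^-1 *: (Rintegral mu `[s, t] (h (u + a)) - Rintegral mu `[s, t] (h a)) @[u --> 0^']
    --> Rintegral mu `[s, t] (partial1of2 h a).
  rewrite d1I; apply: DeriveDef.
    apply/cvg_ex; exists (Rintegral mu `[s, t] (partial1of2 h a)).
    by under eq_fun do rewrite scaler1.
  by apply/cvg_lim => //; under eq_fun do rewrite scaler1.
apply: (@cvg_differentiation_under_integral R _ _ mu h `[s, t] _ a (a - 1) (a + 1) aI
  _ _ (fun=> M)) => //.
- by move=> u _; exact: continuous_itv_integrable.
- by move=> _; apply: le_trans (normr_ge0 _) (dM a 0 _); rewrite subrr normr0.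
- by apply: continuous_itv_integrable; exact: cst_continuous.
- by move=> u x /uI ua _; rewrite partial1of2E; have [_ ->] := dhh u x; exact: dM.
Qed.

Lemma is_cderive_cintegral (h dh : R -> R -> R[i]) s t (a M : R) :
  (forall u, ccontinuous (h u)) -> (forall u, ccontinuous (dh u)) ->
  (forall u x : R, is_cderive u (h ^~ x) (dh u x)) ->
  (forall u x : R, `|u - a| < 1 -> `|dh u x| <= M%:C) ->
  is_cderive a (fun u => cintegral s t (h u)) (cintegral s t (dh a)).
Proof.
move=> ch cdh dhh dM; split => /=.
  apply: (@is_derive_Rintegral (fun u x => Re (h u x)) (fun u x => Re (dh u x)) s t a M).
  - by move=> u; have [] := ch u.
  - by move=> u; have [] := cdh u.
  - by move=> u x; have [] := dhh u x.
  - by move=> u x ua; apply: ler_Re_norm; exact: dM.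
apply: (@is_derive_Rintegral (fun u x => Im (h u x)) (fun u x => Im (dh u x)) s t a M).
- by move=> u; have [] := ch u.
- by move=> u; have [] := cdh u.
- by move=> u x; have [] := dhh u x.
- by move=> u x ua; apply: ler_Im_norm; exact: dM.
Qed.

Lemma cintegral_deriv s t f df : s < t -> ccontinuous df ->
  (forall u : R, is_cderive u f (df u)) -> cintegral s t df = f t - f s.
Proof.
move=> st [cd1 cd2] ff.
have FTC (F G : R -> R) : continuous G -> (forall u : R, is_derive u 1 F (G u)) ->
    Rintegral mu `[s, t] G = F t - F s.
  move=> cG FG.
  have cF : continuous F.
    by move=> u; apply: differentiable_continuous; apply/derivable1_diffP; exact: ex_derive.
  rewrite /Rintegral (@continuous_FTC2 _ G F)//.
  - exact: continuous_subspaceT.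
  - split; [by move=> u _; exact: ex_derive| |].
      by apply: cvg_at_right_filter; exact: cF.
    by apply: cvg_at_left_filter; exact: cF.
  - by move=> u _; rewrite derive1E; have [_ ->] := FG u.
apply: complex_ext; rewrite ?(cReD, cImD, cReN, cImN)/=.
  by apply: (FTC (fun u => Re (f u))) => // u; have [] := ff u.
by apply: (FTC (fun u => Im (f u))) => // u; have [] := ff u.
Qed.

End complex_functions.

(** * The one-variable contour integrals *)

Section bethe_kernel.
Context {R : realType} (r : R).
Hypotheses (r0 : 0 < r) (r1 : r < 1).
Implicit Types (a : nat) (n : int) (t u : R).
Local Notation I := (0 +i* 1 : R[i]).

Definition circ u : R[i] := r%:C * cexp (0 +i* u).

Lemma norm_circ u : `|circ u| = r%:C.
Proof.
by rewrite /circ normrM norm_cexp/= expR0 mulr1 normc_def/= expr0n addr0 sqrtr_sqr gtr0_norm.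
Qed.

Lemma circ_neq0 u : circ u != 0.
Proof. by rewrite -normr_gt0 norm_circ ltcR. Qed.

Lemma norm_1Bcirc u : (1 - r)%:C <= `|1 - circ u|.
Proof.
apply: le_trans (lerB_dist _ _).
by rewrite normr1 norm_circ rmorphB.
Qed.

Lemma circ_neq1 u : 1 - circ u != 0.
Proof. by rewrite -normr_gt0; apply: lt_le_trans (norm_1Bcirc u); rewrite ltcR subr_gt0. Qed.

Lemma ccontinuous_circ : ccontinuous circ.
Proof.
apply: ccontinuousM; first exact: ccontinuous_cst.
by apply: ccontinuous_cexp; split; [exact: cst_continuous|move=> x; exact: cvg_id].
Qed.

Definition bethe_kernel a n t (z : R[i]) : R[i] :=
  z ^ (n - 1) * (1 - z)^-1 ^+ a * cexp (epsilon z * t%:C).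

(** The integrand pulled back to the angle: [I * circ u] is the derivative of [circ u] in [u]. *)
Definition bethe_kernel_circ a n t u := bethe_kernel a n t (circ u) * (I * circ u).

Lemma bethe_kernel_circE a n t u : bethe_kernel_circ a n t u =
  I * circ u ^ n * (1 - circ u)^-1 ^+ a * cexp (epsilon (circ u) * t%:C).
Proof.
rewrite /bethe_kernel_circ /bethe_kernel expfzDr ?circ_neq0//.
by rewrite exprN1; field; exact: circ_neq0.
Qed.

Lemma ccontinuous_bethe_kernel_circ a n t : ccontinuous (bethe_kernel_circ a n t).
Proof.
have cc := ccontinuous_circ.
rewrite (_ : bethe_kernel_circ a n t = fun u => I * circ u ^ n * (1 - circ u)^-1 ^+ a *
  cexp (epsilon (circ u) * t%:C)); last by apply/funext => u; exact: bethe_kernel_circE.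
apply: ccontinuousM; [apply: ccontinuousM; [apply: ccontinuousM|]|].
- exact: ccontinuous_cst.
- exact/ccontinuous_expz/cc/circ_neq0.
- apply/ccontinuousX/ccontinuousV; first exact: circ_neq1.
  by apply: ccontinuousD; [exact: ccontinuous_cst|exact: ccontinuousN].
- apply: ccontinuous_cexp; apply: ccontinuousM; last exact: ccontinuous_cst.
  rewrite /epsilon; apply: ccontinuousD; last exact: ccontinuous_cst.
  by apply: ccontinuousV => //; exact: circ_neq0.
Qed.

(** On the circle the modulus of [1 - z] is at least [1 - r], and that of [epsilon z] is at most
    [r^-1 + 1]. The factor [r ^ n] is kept apart because it controls both the growth in the
    positions and the vanishing at time 0. *)
Lemma norm_bethe_kernel_circ a n t u (T : R) : `|t| <= T ->
  `|bethe_kernel_circ a n t u| <= (r ^ n * ((1 - r)^-1 ^+ a * expR ((r^-1 + 1) * T)))%:C.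
Proof.
move=> tT.
have T0 : 0 <= T by exact: le_trans tT.
have rn0 : 0 <= r ^ n by rewrite exprz_ge0// ltW.
have q0 : 0 <= (1 - r)^-1 by rewrite invr_ge0 subr_ge0 ltW.
rewrite bethe_kernel_circE 3!normrM -[X in X <= _]mulrA rmorphM; apply: ler_pM.
- by rewrite mulr_ge0.
- by rewrite mulr_ge0.
- have -> : `|I| = 1 by rewrite normc_def/= expr0n/= expr1n add0r sqrtr1.
  rewrite mul1r.
  have -> : `|circ u ^ n| = `|circ u| ^ n by case: (n) => k; rewrite /exprz ?normfV normrX.
  by rewrite norm_circ fmorphXz.
- rewrite rmorphM; apply: ler_pM => //.
    rewrite normrX rmorphXn; apply: lerXn2r; rewrite ?nnegrE//; first by rewrite ler0c.
    rewrite normfV fmorphV lef_pV2 ?posrE ?normr_gt0 ?circ_neq1// ?ltcR ?subr_gt0//.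
    exact: norm_1Bcirc.
  rewrite norm_cexp lecR ler_expR cReM [complex.Im t%:C]/= mulr0 subr0.
  apply: le_trans (ler_norm _) _; rewrite normrM; apply: ler_pM => //.
  apply: ler_Re_norm; apply: le_trans (ler_normB _ _) _.
  by rewrite normfV norm_circ normr1 rmorphD fmorphV.
Qed.

(** Differentiation in time brings down [epsilon z], that is [z^-1 - 1], and the factor [z^-1]
    lowers [n] by one. *)
Lemma is_cderive_bethe_kernel_circ a n t u :
  is_cderive t (fun s => bethe_kernel_circ a n s u)
    (bethe_kernel_circ a (n - 1) t u - bethe_kernel_circ a n t u).
Proof.
under eq_fun do rewrite bethe_kernel_circE.
rewrite !bethe_kernel_circE expfzDr ?circ_neq0// exprN1.
set A := _ * _ ^+ a; have H := is_cderiveZ A (is_cderive_cexp t (epsilon (circ u))).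
congr is_cderive: H; rewrite /A /epsilon; ring.
Qed.

Lemma twopi_i_neq0 : 2 * pi%:C * I != 0.
Proof.
rewrite !mulf_neq0 ?pnatr_eq0//; first by rewrite fmorph_eq0 gt_eqF// pi_gt0.
by apply/eqP => -[/eqP]; rewrite oner_eq0.
Qed.

Definition entry a n t : R[i] :=
  (2 * pi%:C * I)^-1 * cintegral 0 (2 * pi) (bethe_kernel_circ a n t).

(** Under the integral the difference produces a factor [1 - z], which cancels one of the [a.+1]
    denominators. *)
Lemma entry_rec a n t : entry a.+1 n t - entry a.+1 (n + 1) t = entry a n t.
Proof.
have c := ccontinuous_bethe_kernel_circ.
rewrite /entry -mulrBr; congr (_ * _).
rewrite -[X in _ - X]mul1r -mulNr -cintegralZ// -cintegralD//; last first.
  by apply: ccontinuousM => //; exact: ccontinuous_cst.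
congr cintegral; apply/funext => u; rewrite !bethe_kernel_circE.
rewrite (exprzDr _ _ 1) ?unitfE ?circ_neq0// expr1z exprS.
by field; exact: circ_neq1.
Qed.

Lemma is_cderive_entry a n t : is_cderive t (entry a n) (entry a (n - 1) t - entry a n t).
Proof.
have c := ccontinuous_bethe_kernel_circ.
rewrite /entry -mulrBr; apply: is_cderiveZ.
have -> : cintegral 0 (2 * pi) (bethe_kernel_circ a (n - 1) t) -
  cintegral 0 (2 * pi) (bethe_kernel_circ a n t) =
  cintegral 0 (2 * pi) (fun u => bethe_kernel_circ a (n - 1) t u - bethe_kernel_circ a n t u).
  rewrite -[X in _ - X]mul1r -mulNr -cintegralZ// -cintegralD//; last first.
    by apply: ccontinuousM => //; exact: ccontinuous_cst.
  by congr cintegral; apply/funext => u; rewrite mulN1r.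
have [M HM] : exists M : R, forall s u : R, `|s - t| < 1 ->
    `|bethe_kernel_circ a (n - 1) s u - bethe_kernel_circ a n s u| <= M%:C.
  exists (r ^ (n - 1) * ((1 - r)^-1 ^+ a * expR ((r^-1 + 1) * (`|t| + 1))) +
    r ^ n * ((1 - r)^-1 ^+ a * expR ((r^-1 + 1) * (`|t| + 1)))) => s u st.
  have sT : `|s| <= `|t| + 1.
    by rewrite -[s](subrK t) addrC (le_trans (ler_normD _ _))// lerD2l ltW.
  rewrite rmorphD; apply: le_trans (ler_normB _ _) _.
  by apply: lerD; exact: norm_bethe_kernel_circ.
apply: (is_cderive_cintegral (dh := fun s u =>
  bethe_kernel_circ a (n - 1) s u - bethe_kernel_circ a n s u)) HM => //.
- by move=> s; apply: ccontinuousD => //; exact: ccontinuousN.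
- by move=> s u; exact: is_cderive_bethe_kernel_circ.
Qed.

Lemma entry_bound a (T : R) : 0 <= T -> exists2 C : R, 0 <= C &
  forall n t, `|t| <= T -> `|entry a n t| <= (C * r ^ n)%:C.
Proof.
move=> T0; pose K := (1 - r)^-1 ^+ a * expR ((r^-1 + 1) * T).
have q0 : 0 <= (1 - r)^-1 by rewrite invr_ge0 subr_ge0 ltW.
have K0 : 0 <= K by rewrite mulr_ge0 ?exprn_ge0 ?expR_ge0.
have pi2 : 0 <= 2 * pi :> R by rewrite mulr_ge0 ?pi_ge0.
(* The 2 comes from bounding the real and imaginary parts separately; the length [2 * pi] of the
   interval cancels against the normalization. *)
exists (2 * K) => [|n t tT]; first by rewrite mulr_ge0.
have [c1 c2] := ccontinuous_bethe_kernel_circ a n t.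
have bRe : `|complex.Re (cintegral 0 (2 * pi) (bethe_kernel_circ a n t))| <= r ^ n * K * (2 * pi).
  have := @Rintegral_le_bound _ _ _ _ (r ^ n * K) pi2 c1; rewrite subr0; apply => u.
  by apply: ler_Re_norm; exact: norm_bethe_kernel_circ.
have bIm : `|complex.Im (cintegral 0 (2 * pi) (bethe_kernel_circ a n t))| <= r ^ n * K * (2 * pi).
  have := @Rintegral_le_bound _ _ _ _ (r ^ n * K) pi2 c2; rewrite subr0; apply => u.
  by apply: ler_Im_norm; exact: norm_bethe_kernel_circ.
rewrite /entry normrM normfV.
have -> : `|2 * pi%:C * I| = (2 * pi)%:C.
  rewrite !normrM normr_nat [X in _ * X * _]ger0_norm ?ler0c ?pi_ge0//.
  by rewrite (_ : `|I| = 1) ?mulr1 ?rmorphM ?rmorph_nat// normc_def/= expr0n/= expr1n add0r sqrtr1.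
have p0 : (2 * pi)%:C != 0 :> R[i] by rewrite fmorph_eq0 mulf_neq0// gt_eqF// pi_gt0.
rewrite mulrC ler_pdivrMr; last by rewrite ltcR mulr_gt0// pi_gt0.
rewrite [X in `|X|]complexE; apply: le_trans (ler_normD _ _) _.
rewrite normrM (_ : `|'i%C| = 1 :> R[i]) ?mul1r; last first.
  by rewrite normc_def/= expr0n/= expr1n add0r sqrtr1.
rewrite !normc_def/= expr0n !addr0 !sqrtr_sqr -rmorphD -rmorphM lecR -/K.
by rewrite (_ : 2 * K * _ * _ = r ^ n * K * (2 * pi) + r ^ n * K * (2 * pi)) ?lerD//; ring.
Qed.

(** With [a = 0] and [t = 0] the integrand is a multiple of the character of frequency [n], whose
    integral over a full period vanishes unless [n = 0]. *)
Lemma entry0_init n : entry 0 n 0 = (n == 0)%:R.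
Proof.
have E u : bethe_kernel_circ 0 n 0 u = I * (r ^ n)%:C * cexp ((0 +i* n%:~R) * u%:C).
  rewrite bethe_kernel_circE expr0 mulr1 mulr0 cexp0 mulr1 -mulrA; congr (_ * _).
  rewrite /circ expfzMl fmorphXz cexp_expz; congr (_ * cexp _).
  rewrite -mulrzr -(rmorph_int (real_complex R)).
  by apply: complex_ext; rewrite !(cReM, cImM)/=; ring.
rewrite /entry (_ : bethe_kernel_circ 0 n 0 =
  fun u => I * (r ^ n)%:C * cexp ((0 +i* n%:~R) * u%:C)); last exact/funext.
have ce : ccontinuous (fun u => cexp ((0 +i* n%:~R) * u%:C) : R[i]).
  apply: ccontinuous_cexp; apply: ccontinuousM; first exact: ccontinuous_cst.
  by split; [move=> x; exact: cvg_id|exact: cst_continuous].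
rewrite cintegralZ//.
have pi0 : 0 < 2 * pi :> R by rewrite mulr_gt0// pi_gt0.
have [->|n0] := eqVneq n 0.
  rewrite expr0z mulr1 (_ : cintegral _ _ _ = 2 * pi%:C); last first.
    rewrite (_ : (fun _ => _) = fun=> 1); last first.
      by apply/funext => u; rewrite (_ : (0 +i* _) = 0) ?mul0r ?cexp0.
    apply: complex_ext; rewrite /= Rintegral_cst//= lebesgue_measure_itv/= lte_fin pi0.
      by rewrite /=; ring.
    by rewrite /=; ring.
  by rewrite ['i%C * _]mulrC mulVf// twopi_i_neq0.
have n0' : (0 +i* n%:~R) != 0 :> R[i].
  by apply/eqP => -[/eqP]; rewrite intr_eq0 (negbTE n0).
rewrite (_ : cintegral _ _ _ = 0) ?mulr0//.
have D u : is_cderive u (fun u => (0 +i* n%:~R)^-1 * cexp ((0 +i* n%:~R) * u%:C))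
   (cexp ((0 +i* n%:~R) * u%:C)).
  have := is_cderiveZ (0 +i* n%:~R)^-1 (is_cderive_cexp u (0 +i* n%:~R)).
  by rewrite mulrA mulVf// mul1r.
rewrite (cintegral_deriv pi0 ce D) -mulrBr.
rewrite (_ : (0 +i* n%:~R) * (2 * pi)%:C = (0 +i* (pi *+ 2)) *~ n); last first.
  rewrite -[RHS]mulrzr -(rmorph_int (real_complex R)).
  by apply: complex_ext; rewrite !(cReM, cImM)/= -mulr_natl; ring.
rewrite -cexp_expz mulr0 cexp0 [cexp _](_ : _ = 1) ?exp1rz ?subrr ?mulr0//.
by rewrite /cexp/= expR0 cos2pi sin2pi mul1r.
Qed.

(* By the recursion and induction on [a] the value does not depend on [n > 0],
   and it is O(r ^ n). *)
Lemma entry_init_gt0 a n : 0 < n -> entry a n 0 = 0.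
Proof.
elim: a n => [|a IH] n n0; first by rewrite entry0_init gt_eqF.
have [C C0 CF] := entry_bound a.+1 (lexx 0).
have const (k : nat) : entry a.+1 n 0 = entry a.+1 (n + k%:Z) 0.
  elim: k => [|k ->]; first by rewrite addr0.
  apply/eqP; rewrite -subr_eq0 intS [1 + _]addrC addrA entry_rec IH//.
  by rewrite ltr_wpDr.
have le k : `|entry a.+1 n 0| <= ((C * r ^ n) * r ^+ k)%:C.
  by rewrite (const k) -mulrA -[r ^+ k]/(r ^ k%:Z) -expfzDr ?gt_eqF// CF ?normr0.
apply/eqP; rewrite -normr_le0 normc_def lecR.
have cv : (C * r ^ n * r ^+ k) @[k --> \oo] --> C * r ^ n * 0.
  by apply: cvgM; [exact: cvg_cst|apply: cvg_expr; rewrite gtr0_norm].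
rewrite mulr0 in cv; apply: (cvgr_to_ge cv); apply: nearW => k.
by have := le k; rewrite normc_def lecR.
Qed.

Lemma entry_init0 a : entry a 0 0 = 1.
Proof.
elim: a => [|a IH]; first by rewrite entry0_init eqxx.
by have := entry_rec a 0 0; rewrite add0r (@entry_init_gt0 a.+1 1 isT) subr0 IH.
Qed.

(** From the value 1 at [n = 0], each step down changes [entry r 1] by a value of [entry r 0] at a
    negative index, which is 0. *)
Lemma entry1_init_le0 n : n <= 0 -> entry 1 n 0 = 1.
Proof.
move=> n0; have -> : n = - (`|n|%N)%:Z by lia.
elim: `|n|%N => [|k IH]; first by rewrite oppr0 entry_init0.
have := entry_rec 0 (- k.+1%:Z) 0.
rewrite (_ : - k.+1%:Z + 1 = - k%:Z) ?IH; last by lia.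
by rewrite entry0_init => /eqP; rewrite subr_eq add0r => /eqP.
Qed.

End bethe_kernel.

(** * The determinant *)

(* The exponent of 1/(1 - xi_i) left in the integrand once the Vandermonde
   product is taken apart. *)
Definition expo (N i : nat) : nat := if i == 0%N then N.-1 else (N - i)%N.

(** Row [i] belongs to particle [i], and column [m] to the power [m] of its variable picked from the
    Vandermonde product. The entries are an abstract [f], so that the identities below rest on
    recursions and initial values alone. *)
Definition bethe_mx {K : Type} (N : nat) (f : nat -> int -> K) (x : int)
    (Y : 'I_N -> int) : 'M[K]_N :=
  \matrix_(i, m) f (expo N i) (x - Y i + m%:Z).

Definition advance (N : nat) (Y : {ffun 'I_N -> int}) (k : 'I_N) : {ffun 'I_N -> int} :=
  [ffun j => if j == k then Y k + 1 else Y j].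

Section bethe_determinant.
Context {K : comNzRingType} (f : nat -> int -> K).

(** The first two particles have the same exponent [N.-1], so equal positions give equal rows. This
    is the boundary condition for the first class particle overtaking its neighbour. *)
Lemma det_bethe_swap N (x : int) (Y : 'I_N -> int) (i j : 'I_N) :
  val i = 0%N -> val j = 1%N -> Y i = Y j -> \det (bethe_mx f x Y) = 0.
Proof.
move=> i0 j1 Yij; apply: (@determinant_alternate _ _ _ i j).
  by rewrite -val_eqE i0 j1.
move=> m; rewrite !mxE Yij; congr (f _ _).
by rewrite /expo i0 j1 /= subn1.
Qed.

Hypothesis f_rec : forall a n, f a.+1 n - f a.+1 (n + 1) = f a n.

(** By [f_rec], advancing particle [i] adds to its row the same row with the exponent and the
    argument lowered by one. For [0 < i] and [Y j = Y i + 1] this is the row of particle [j], so the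
    determinant does not change. *)
Lemma det_bethe_exclusion N (x : int) (Y : {ffun 'I_N -> int}) (i j : 'I_N) :
  (0 < i)%N -> j = i.+1 :> nat -> Y j = Y i + 1 ->
  \det (bethe_mx f x (advance Y i)) = \det (bethe_mx f x Y).
Proof.
move=> i0 ji Yj; have ij : i != j by rewrite -val_eqE /= ji; lia.
pose C : 'M[K]_N := \matrix_(k, m) if k == i then f (expo N i).-1 (x - Y i - 1 + m%:Z)
  else f (expo N k) (x - Y k + m%:Z).
have ei : expo N i = (expo N j).+1.
  by rewrite /expo ji /=; have := ltn_ord j; rewrite ji; case: eqP; lia.
have C0 : \det C = 0.
  apply: (@determinant_alternate _ _ _ i j) => // m.
  rewrite !mxE eqxx eq_sym (negbTE ij) ei Yj; congr (f _ _); lia.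
rewrite -[RHS]addr0 -C0 -[\det (bethe_mx f x Y)]mul1r -[\det C]mul1r.
apply: (@determinant_multilinear _ _ _ _ _ i).
- apply/rowP => m; rewrite !mxE !mul1r eqxx ffunE eqxx ei /=.
  have := f_rec (expo N j) (x - Y i - 1 + m%:Z).
  have -> : x - Y i - 1 + m%:Z + 1 = x - Y i + m%:Z by lia.
  have -> : x - (Y i + 1) + m%:Z = x - Y i - 1 + m%:Z by lia.
  by move=> <-; rewrite addrC subrK.
- apply/matrixP => k m; rewrite !mxE ffunE.
  by have := neq_lift i k; rewrite eq_sym => /negbTE ->.
- apply/matrixP => k m; rewrite !mxE ffunE.
  by have := neq_lift i k; rewrite eq_sym => /negbTE ->.
Qed.

Hypothesis f_gt0 : forall a n, 0 < n -> f a n = 0.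
Hypothesis f0 : forall n, f 0 n = (n == 0)%:R.
Hypothesis f1 : forall n, n <= 0 -> f 1 n = 1.

(* If [Y ord0 < x] the first row is zero. Otherwise the last row consists of
   ones, and subtracting from each column the next one lowers the exponents and
   leaves the matrix of the first [N] particles. *)
Lemma det_bethe_init N (x : int) (Y : 'I_N.+1 -> int) :
  (forall i j : 'I_N.+1, (i < j)%N -> Y i < Y j) ->
  \det (bethe_mx f x Y) = (Y ord0 == x)%:R.
Proof.
elim: N Y => [|N IH] Y Yinc.
  by rewrite det_mx11 mxE /expo/= f0 addr0 subr_eq0 eq_sym.
have [Y0x|xY0] := ltP (Y ord0) x.
  rewrite (expand_det_row _ ord0) big1 => [|m _]; first by rewrite lt_eqF.
  by rewrite mxE f_gt0 ?mul0r// ; lia.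
(* Integer positions grow by at least one per index; for the last particle this makes every argument
   in its row nonpositive. *)
have Yge (i : 'I_N.+2) : x + i%:Z <= Y i.
  case: i => i; elim: i => [|i IHi] iN.
    by rewrite addr0 (le_trans xY0)// (_ : Ordinal iN = ord0)//; exact: val_inj.
  have := Yinc (Ordinal (ltnW iN)) (Ordinal iN) (ltnSn _).
  have := IHi (ltnW iN); rewrite /=; lia.
set A := bethe_mx f x Y.
(* Right multiplication by this unitriangular matrix subtracts from each column the next one and
   leaves the last column alone. *)
pose U : 'M[K]_N.+2 := \matrix_(k, l) ((k == l)%:R - (k == l.+1 :> nat)%:R).
have detU : \det U = 1.
  rewrite det_trig; last first.
    apply/is_trig_mxP => i j ij; rewrite mxE -val_eqE /= !ltn_eqF ?subrr//.
    exact: ltnW.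
  by apply: big1 => i _; rewrite mxE eqxx (ltn_eqF (ltnSn _)) subr0.
have AU i (l : 'I_N.+1) : (A *m U) i (lift ord_max l) =
    A i (lift ord_max l) - A i (lift ord0 l).
  rewrite mxE; under eq_bigr do rewrite [U _ _]mxE mulrBr.
  have delta (j : 'I_N.+2) : \sum_k A i k * (k == j)%:R = A i j.
    by rewrite (bigD1 j)//= eqxx mulr1 big1 ?addr0// => k /negbTE ->; rewrite mulr0.
  rewrite sumrB delta -[in RHS](delta (lift ord0 l)); congr (_ - _).
  by apply: eq_bigr => k _; rewrite -(inj_eq val_inj k (lift ord0 l))
    [val (lift ord0 _)]lift0 lift_max.
have last1 m : A ord_max m = 1.
  rewrite mxE /expo/= subSnn f1//.
  by have := Yge ord_max; have := ltn_ord m; rewrite /=; lia.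
rewrite -[LHS]mulr1 -[X in _ * X = _]detU -det_mulmx (expand_det_row _ ord_max).
rewrite (bigD1 ord_max)//= big1 ?addr0; last first.
  move=> m; case: (unliftP ord_max m) => [l ->|->]; last by rewrite eqxx.
  by rewrite AU !last1 subrr mul0r.
have -> : (A *m U) ord_max ord_max = 1.
  rewrite mxE; under eq_bigr do rewrite last1 mul1r [U _ _]mxE.
  rewrite (bigD1 ord_max)//= eqxx (ltn_eqF (ltnSn _)) subr0 big1 ?addr0// => k.
  move=> /negbTE ->; rewrite sub0r ltn_eqF ?oppr0//; exact: ltn_ord.
rewrite mul1r /cofactor -signr_odd oddD addbb expr0 mul1r.
transitivity (\det (bethe_mx f x (fun i => Y (lift ord_max i)))); last first.
  rewrite IH => [|i j ij]; last by apply: Yinc; rewrite !lift_max.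
  by rewrite (_ : lift ord_max ord0 = ord0)//; apply: val_inj; rewrite /= /bump leqn0.
congr (\det _); apply/matrixP => i l.
rewrite 2!mxE AU !mxE lift0 lift_max.
have -> : expo N.+2 i = (expo N.+1 i).+1.
  by rewrite /expo; case: eqP => // _; rewrite subSn// ltnW.
by rewrite lift_max -[RHS]f_rec intS [1 + _]addrC addrA.
Qed.

End bethe_determinant.

(** * The determinant of contour integrals as a function of time *)

Section bethe_solution.
Context {R : realType} (r : R).
Hypotheses (r0 : 0 < r) (r1 : r < 1).

Definition bethe (N : nat) (x : int) (Y : {ffun 'I_N -> int}) (t : R) : R[i] :=
  \det (bethe_mx (fun a n => entry r a n t) x Y).

(** In each term of the Leibniz expansion, differentiating the factor of row [k] lowers its argument
    by one, which is what advancing particle [k] does. The free equation thus holds for every [Y],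
    ordered or not. *)
Lemma is_cderive_bethe N x (Y : {ffun 'I_N -> int}) t :
  is_cderive t (bethe x Y) (\sum_(k < N) (bethe x (advance Y k) t - bethe x Y t)).
Proof.
pose n (s : 'S_N) i := x - Y i + (s i)%:Z.
have E u (Z : {ffun 'I_N -> int}) : bethe x Z u = \sum_(s : 'S_N) (-1) ^+ s *
    \prod_(i < N) entry r (expo N i) (x - Z i + (s i)%:Z) u.
  by apply: eq_bigr => s _; congr (_ * _); apply: eq_bigr => i _; rewrite mxE.
have := is_cderive_sum (index_enum _) (fun s : 'S_N => is_cderiveZ ((-1) ^+ s)
  (is_cderive_prod (fun i => is_cderive_entry r0 r1 (expo N i) (n s i) t))).
congr is_cderive; first by apply/funext => u; rewrite E.
under [RHS]eq_bigr do rewrite !E -sumrB.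
rewrite exchange_big/=; apply: eq_bigr => s _.
rewrite mulr_sumr; apply: eq_bigr => k _; rewrite -mulrBr; congr (_ * _).
rewrite (bigD1 k)//= eqxx [X in _ = X - _](bigD1 k)//= [X in _ = _ - X](bigD1 k)//=.
rewrite ffunE eqxx.
have -> : \prod_(i < N | i != k) (if i == k then
    entry r (expo N i) (n s i - 1) t - entry r (expo N i) (n s i) t
    else entry r (expo N i) (n s i) t) = \prod_(i < N | i != k) entry r (expo N i) (n s i) t.
  by apply: eq_bigr => i /negbTE ->.
have -> : \prod_(i < N | i != k) entry r (expo N i) (x - advance Y k i + s i) t =
    \prod_(i < N | i != k) entry r (expo N i) (n s i) t.
  by apply: eq_bigr => i /negbTE ik; rewrite ffunE ik.
by rewrite mulrBl (_ : x - (Y k + 1) + s k = n s k - 1)// /n; lia.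
Qed.

(** Each entry is bounded by a multiple of [r ^ n] with [n] at least minus the sum of the absolute
    values of [x] and [Y i], and [r^-1] is at least 1. *)
Lemma bethe_bound N x (T : R) : 0 <= T -> exists2 D : R, 0 <= D &
  forall (Y : {ffun 'I_N -> int}) t, `|t| <= T ->
    `|bethe x Y t| <= (D * \prod_(i < N) r^-1 ^+ `|Y i|%N)%:C.
Proof.
move=> T0; pose q := r^-1.
have q0 : 0 <= q by rewrite invr_ge0 ltW.
have q1 : 1 <= q by rewrite invf_ge1// ltW.
have H a : exists C : R, 0 <= C /\ forall n t, `|t| <= T -> `|entry r a n t| <= (C * r ^ n)%:C.
  by have [C C0 CF] := entry_bound r0 r1 a T0; exists C.
have [C CP] := choice H.
have pow n (k : nat) : - k%:Z <= n -> r ^ n <= q ^+ k.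
  move=> kn; rewrite -[n in leLHS]opprK -exprz_inv.
  by apply: (@ler_weXz2l _ q q1 (- n) k); lia.
exists (\sum_(s : 'S_N) \prod_(i < N) (C (expo N i) * q ^+ `|x|%N)) => [|Y t tT].
  apply: sumr_ge0 => s _; apply: prodr_ge0 => i _; rewrite mulr_ge0 ?exprn_ge0//.
  by have [] := CP (expo N i).
apply: le_trans (ler_norm_sum _ _ _) _; rewrite mulr_suml rmorph_sum.
apply: ler_sum => s _; rewrite normrM normrX normrN1 expr1n mul1r.
rewrite -big_split/= normr_prod rmorph_prod; apply: ler_prod => i _.
rewrite normr_ge0/= mxE; have [C0 CF] := CP (expo N i).
apply: le_trans (CF _ _ tT) _; rewrite lecR -mulrA ler_wpM2l// -exprD.
by apply: pow; lia.
Qed.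

Lemma bethe_init N x (Y : {ffun 'I_N -> int}) (hN : (0 < N)%N) :
  (forall i j : 'I_N, (i < j)%N -> Y i < Y j) ->
  bethe x Y 0 = (Y (Ordinal hN) == x)%:R.
Proof.
case: N Y hN => // N Y hN Yinc.
rewrite /bethe (@det_bethe_init _ (fun a n => entry r a n 0) _ _ _ _ N x Y Yinc).
- by congr (_ == _)%:R; congr (Y _); exact: val_inj.
- by move=> a n; exact: entry_rec.
- by move=> a n; exact: entry_init_gt0.
- by move=> n; exact: entry0_init.
- by move=> n; exact: entry1_init_le0.
Qed.

End bethe_solution.

(** * The multiple contour integral *)

Section iterated_integral.
Context {R : realType} (r : R).
Local Notation I := (0 +i* 1 : R[i]).

Definition circle_continuous (f : R[i] -> R[i]) :=
  ccontinuous (fun u => f (circ r u) * (I * circ r u)).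

Lemma circle_integral_sum (J : finType) (c : J -> R[i]) (g : J -> R[i] -> R[i]) :
  (forall j, circle_continuous (g j)) ->
  circle_integral r (fun z => \sum_j c j * g j z) =
  \sum_j c j * circle_integral r (g j).
Proof.
move=> cg.
(* Continuity of the partial sums is carried through the induction because additivity of [cintegral]
   uses it. *)
have H (s : seq J) : ccontinuous (fun u => \sum_(j <- s) c j * (g j (circ r u) * (I * circ r u)))
   /\ cintegral 0 (2 * pi) (fun u => \sum_(j <- s) c j * (g j (circ r u) * (I * circ r u))) =
      \sum_(j <- s) c j * circle_integral r (g j).
  elim: s => [|j s [IH1 IH2]].
    under eq_fun do rewrite big_nil; split; first exact: ccontinuous_cst.
    by rewrite big_nil cintegral0.
  have cj : ccontinuous (fun u => c j * (g j (circ r u) * (I * circ r u))).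
    by apply: ccontinuousM; [exact: ccontinuous_cst|exact: cg].
  under eq_fun do rewrite big_cons; split; first exact: ccontinuousD.
  by rewrite cintegralD// IH2 big_cons cintegralZ//; exact: cg.
rewrite -(H (index_enum J)).2; congr cintegral; apply/funext => u /=.
by rewrite mulr_suml; apply: eq_bigr => j _; rewrite -mulrA.
Qed.

(** Once the first variable is fixed, its factor joins the coefficients, and the induction
    hypothesis evaluates the inner integral to a finite sum of one-variable functions. *)
Lemma iter_circle_integral_prod (J : finType) n (c : J -> R[i])
    (g : J -> 'I_n -> R[i] -> R[i]) :
  (forall j i, circle_continuous (g j i)) ->
  iter_circle_integral r (fun xi : n.-tuple R[i] =>
    \sum_j c j * \prod_(i < n) g j i (tnth xi i)) =
  \sum_j c j * \prod_(i < n) circle_integral r (g j i).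
Proof.
elim: n c g => [|n IH] c g cg.
  by apply: eq_bigr => j _; rewrite !big_ord0.
rewrite /= -/(iter_circle_integral r).
transitivity (circle_integral r (fun z => \sum_j
    (c j * \prod_(i < n) circle_integral r (g j (lift ord0 i))) * g j ord0 z)).
  congr circle_integral; apply/funext => z.
  transitivity (iter_circle_integral r (fun zs : n.-tuple R[i] =>
      \sum_j (c j * g j ord0 z) * \prod_(i < n) g j (lift ord0 i) (tnth zs i))).
    congr iter_circle_integral; apply/funext => zs; apply: eq_bigr => j _.
    rewrite big_ord_recl tnth0 mulrA; congr (_ * _).
    by apply: eq_bigr => i _; rewrite tnthS.
  rewrite (IH (fun j => c j * g j ord0 z) (fun j i => g j (lift ord0 i))) => [|j i]; last exact: cg.
  by apply: eq_bigr => j _; rewrite mulrAC.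
rewrite circle_integral_sum => [|j]; last exact: cg.
by apply: eq_bigr => j _; rewrite big_ord_recl mulrAC mulrA.
Qed.

Hypotheses (r0 : 0 < r) (r1 : r < 1).

Lemma circle_integral_bethe_kernel a n t :
  circle_integral r (bethe_kernel a n t) = 2 * pi%:C * I * entry r a n t.
Proof.
by rewrite /entry mulrA divff ?twopi_i_neq0// mul1r.
Qed.

Lemma prod_Vandermonde N (xi : 'I_N -> R[i]) :
  \prod_(i < N) \prod_(j < N | (i < j)%N) (xi j - xi i) =
  \sum_(s : 'S_N) (-1) ^+ s * \prod_(i < N) xi i ^+ s i.
Proof.
have := det_Vandermonde (\row_i xi i); rewrite -det_tr => V.
transitivity (\prod_(i < N) \prod_(j < N | (i < j)%N)
   ((\row_i xi i : 'rV_N) 0 j - (\row_i xi i : 'rV_N) 0 i)).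
  by apply: eq_bigr => i _; apply: eq_bigr => j _; rewrite !mxE.
rewrite -V; apply: eq_bigr => s _; congr (_ * _); apply: eq_bigr => i _.
by rewrite !mxE.
Qed.

(** Expanding the Vandermonde product over permutations makes each term a product of one-variable
    functions; their integrals assemble into the Leibniz formula. *)
Lemma iter_circle_integral_bethe N (hN : (0 < N)%N) (Y : {ffun 'I_N -> int}) (x : int) (t : R) :
  (1 / (2 * pi%:C * I)) ^+ N *
  iter_circle_integral r (fun xi : N.-tuple R[i] =>
    (1 - tnth xi (Ordinal hN)) *
    (\prod_(i < N) \prod_(j < N | (i < j)%N)
       ((tnth xi j - tnth xi i) / (1 - tnth xi i))) *
    (\prod_(i < N) (1 / (1 - tnth xi i))) *
    (\prod_(i < N) (tnth xi i ^ (x - Y i - 1) *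
                    cexp (epsilon (tnth xi i) * t%:C)))) = bethe r x Y t.
Proof.
(* The exponent [N - i.+1] counts the indices [j] above [i], each contributing one denominator to
   the double product. The factor [1 - z] occurs for the first variable only. *)
pose g (s : 'S_N) (i : 'I_N) (z : R[i]) : R[i] :=
  z ^+ s i * (if i == Ordinal hN then 1 - z else 1) * (1 - z)^-1 ^+ (N - i.+1) *
  (1 - z)^-1 * (z ^ (x - Y i - 1) * cexp (epsilon z * t%:C)).
(* The cancellation is carried out on the circle, where [z] and [1 - z] are nonzero. *)
have gk (s : 'S_N) i u :
    g s i (circ r u) = bethe_kernel (expo N i) (x - Y i + (s i)%:Z) t (circ r u).
  have z1 := circ_neq1 r0 r1 u; have z0 := circ_neq0 r0 u.
  have q : (if i == Ordinal hN then 1 - circ r u else 1) *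
      (1 - circ r u)^-1 ^+ (N - i.+1) * (1 - circ r u)^-1 = (1 - circ r u)^-1 ^+ expo N i.
    rewrite /expo -val_eqE /=; case: eqP => [->|_]; last by rewrite mul1r -exprSr subnSK.
    by rewrite mulrAC divff// mul1r subn1.
  have e : circ r u ^+ s i * circ r u ^ (x - Y i - 1) =
      circ r u ^ (x - Y i + (s i)%:Z - 1).
    by rewrite -[_ ^+ _]/(circ r u ^ (s i)%:Z) -expfzDr//; congr (_ ^ _); ring.
  by rewrite /g /bethe_kernel -q -e; ring.
have gc (s : 'S_N) i : circle_continuous (g s i).
  rewrite /circle_continuous.
  rewrite (_ : (fun _ => _) = bethe_kernel_circ r (expo N i) (x - Y i + (s i)%:Z) t).
    exact: ccontinuous_bethe_kernel_circ.
  by apply/funext => u; rewrite gk.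
rewrite (_ : (fun xi : N.-tuple R[i] => _) = fun xi : N.-tuple R[i] =>
    \sum_(s : 'S_N) (-1) ^+ s * \prod_(i < N) g s i (tnth xi i)); last first.
  apply/funext => xi.
  have -> : \prod_(i < N) \prod_(j < N | (i < j)%N) ((tnth xi j - tnth xi i) / (1 - tnth xi i)) =
      \prod_(i < N) \prod_(j < N | (i < j)%N) (tnth xi j - tnth xi i) *
      \prod_(i < N) (1 - tnth xi i)^-1 ^+ (N - i.+1).
    rewrite -big_split; apply: eq_bigr => i _; rewrite big_split/=; congr (_ * _).
    rewrite -prodr_const_nat big_geq_mkord.
    by apply: eq_bigl => j.
  have -> : 1 - tnth xi (Ordinal hN) = \prod_(i < N) (if i == Ordinal hN then 1 - tnth xi i else 1).
    by rewrite -big_mkcond big_pred1_eq.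
  rewrite prod_Vandermonde !(mulr_sumr, mulr_suml); apply: eq_bigr => s _.
  rewrite mulrCA -!mulrA -!big_split/=; congr (_ * _); apply: eq_bigr => i _.
  by rewrite /g div1r -!mulrA.
rewrite iter_circle_integral_prod// mulr_sumr /bethe /determinant.
apply: eq_bigr => s _; rewrite mulrCA; congr (_ * _).
rewrite -[X in _ ^+ X]card_ord -prodr_const -big_split; apply: eq_bigr => i _ /=.
rewrite mxE.
have -> : circle_integral r (g s i) =
    circle_integral r (bethe_kernel (expo N i) (x - Y i + (s i)%:Z) t).
  by congr cintegral; apply/funext => u; exact: (congr1 (fun c => c * (I * circ r u)) (gk s i u)).
by rewrite circle_integral_bethe_kernel mulrA div1r mulVf ?mul1r// twopi_i_neq0.
Qed.

End iterated_integral.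

(** * The TASEP *)

Section markov.
Context {d : measure_display} {T : measurableType d} {R : realType}.
Context (P : probability T R) {S : countType}.
Context (n : nat) (J : S -> 'I_n -> S) (p : R -> S -> S -> R) (Z : R -> T -> S).
Hypothesis pP : is_transition_function
  (fun s s' => \sum_(i < n) ((J s i == s')%:R - (s == s')%:R)) p.
Hypothesis ZP : is_markov_process P p Z.
Variable s0 : S.
Hypothesis Z0 : P [set w | Z 0 w = s0] = 1%E.

(** The Markov property is applied at time 0 with empty past; the event that the process starts
    elsewhere than at [s0] is null. *)
Lemma markov_marginal t s : 0 <= t -> P [set w | Z t w = s] = (p t s0 s)%:E.
Proof.
move=> t0.
have m0 := markov_measurable ZP s0 (lexx 0).
have mt := markov_measurable ZP s t0.
have := markov_property ZP (past := [::]) s0 s (lexx 0) t0 (fun _ => ltac:(by [])).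
rewrite add0r (_ : [set w | _ /\ _] = [set w | Z 0 w = s0]); last first.
  by apply/seteqP; split => w /= [] //.
rewrite Z0 mul1e => <-; rewrite (measureDI _ mt m0) [X in (X + _)%E](_ : _ = 0%E).
  by rewrite add0e; congr (P _); apply/seteqP; split => w /= [].
apply/eqP; rewrite eq_le measure_ge0 andbT.
have -> : 0%E = P (~` [set w | Z 0 w = s0]).
  by rewrite probability_setC// Z0 subee.
apply: le_measure; rewrite ?inE; [exact: measurableD|exact: measurableC|].
by move=> w [].
Qed.

Lemma markov_measurable_set t (E : set S) : 0 <= t -> measurable [set w | E (Z t w)].
Proof.
move=> t0; rewrite (_ : [set w | _] =
  \bigcup_s (if s \in E then [set w | Z t w = s] else set0)); last first.
  apply/seteqP; split => w /=.
    by move=> EZ; exists (Z t w) => //; rewrite mem_set.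
  by case=> s _; case: ifPn => // /set_mem Es ->.
apply: countable_bigcupT_measurable; first exact: countableP.
by move=> s; case: ifP => // _; exact: (markov_measurable ZP).
Qed.

Lemma hit_le_probability t (E : set S) : 0 <= t ->
  ((hit p E s0 t)%:E <= P [set w | E (Z t w)])%E.
Proof.
move=> t0; rewrite (hitE pP)//; apply: ge_ereal_sup => /= _ [X [finX XE] <-].
under eq_fsbigr do rewrite -markov_marginal//.
rewrite -measure_fin_bigcup//; last 2 first.
- apply/trivIsetP => i j _ _ /eqP ij; apply/seteqP; split => // w /= [Zi Zj].
  by apply: ij; rewrite -Zi -Zj.
- by move=> s _; exact: (markov_measurable ZP).
apply: le_measure; rewrite ?inE.
- by apply: fin_bigcup_measurable => // s _; exact: (markov_measurable ZP).
- exact: markov_measurable_set.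
- by move=> w [s Xs /= ->]; exact: XE.
Qed.

(* The lower bound for [E] and for its complement forces equality. *)
Lemma probability_hit t (E : set S) : 0 <= t ->
  fine (P [set w | E (Z t w)]) = hit p E s0 t.
Proof.
move=> t0; have mE := markov_measurable_set E t0.
have fE : P [set w | E (Z t w)] \is a fin_num by exact: fin_num_measure.
apply/eqP; rewrite eq_le -!lee_fin fineK// hit_le_probability// andbT.
have := hit_le_probability (~` E) t0.
have -> : hit p (~` E) s0 t = 1 - hit p E s0 t by rewrite -(hitC pP E s0 t0) addrC addKr.
rewrite (_ : [set w | _] = ~` [set w | E (Z t w)])// probability_setC// -(fineK fE).
by rewrite -EFinB !lee_fin; lra.
Qed.

End markov.

(** * The solution of the backward equation on the states of the TASEP *)

Section word21.
Context {N : nat}.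
Hypothesis hN : (0 < N)%N.

Lemma state_lt (s : state N) (i j : 'I_N) : (i < j)%N -> (val s).1 i < (val s).1 j.
Proof. by case: s => s /= /andP[/forallP/(_ i)/forallP/(_ j)/implyP H _]; exact: H. Qed.

(** A particle with index strictly between would need a site strictly between two neighbouring
    sites. *)
Lemma state_adjacent (s : state N) (i j : 'I_N) :
  (val s).1 j = (val s).1 i + 1 -> j = i.+1 :> nat.
Proof.
move=> Xij; have [ji|ij|/val_inj ji] := ltngtP j i.
- by have := state_lt s ji; lia.
- have [//|Sij|//] := ltngtP j i.+1; first by lia.
  have iN : (i.+1 < N)%N by exact: ltn_trans Sij (ltn_ord j).
  have := @state_lt s i (Ordinal iN) (ltnSn _).
  have := @state_lt s (Ordinal iN) j Sij; lia.
- by move: Xij; rewrite ji; lia.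
Qed.

(** An exchange puts a 2 at index [i.+1], where the word 21...1 has a 1. *)
Lemma jump_word_neq (s : state N) i :
  (val s).2 != word21 N -> (val (jump s i)).2 != word21 N.
Proof.
rewrite /jump SubK /raw_jump; case E : (val s) => [X nu] /= nu21.
case: pickP => [j /eqP Xj|//]; case: ifP => //= /andP[/eqP nui _].
have := @state_adjacent s i j; rewrite E /= => /(_ Xj) ji.
apply/eqP => /ffunP/(_ j); rewrite !ffunE tpermR nui.
by rewrite /= ji.
Qed.

Section solution.
Context {R : realType} (r : R) (x : int).
Hypotheses (r0 : 0 < r) (r1 : r < 1).

Definition backward_solution (s : state N) (t : R) : R[i] :=
  if (val s).2 == word21 N then bethe r x (val s).1 t else 0.

(** The boundary conditions let the free formula cover all jumps from the word 21...1: a move to an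
    empty site is [advance] itself, an exchange is handled by [det_bethe_swap], and a blocked jump
    by [det_bethe_exclusion]. *)
Lemma backward_solution_jump (s : state N) i t : (val s).2 = word21 N ->
  backward_solution (jump s i) t = bethe r x (advance (val s).1 i) t.
Proof.
rewrite /backward_solution /jump SubK /raw_jump; case E : (val s) => [X nu] /= nuE.
case: pickP => [j /eqP Xj|Xi]; last by rewrite /= nuE eqxx.
have := @state_adjacent s i j; rewrite E /= => /(_ Xj) ji.
have nuj : nu j = 1%N by rewrite nuE ffunE /= ji.
have nui : (nu i == 2%N) = (val i == 0%N) by rewrite nuE ffunE; case: (val i == 0%N).
rewrite nuj eqxx andbT nui; have [i0|i0] := eqVneq (val i) 0%N.
  (* The first particle overtakes the second: the word changes, so the left side is 0, while on the
     right the first two positions coincide. *)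
  rewrite /= ifN; last first.
    by apply/eqP => /ffunP/(_ j); rewrite !ffunE tpermR nuE ffunE i0 /= ji.
  rewrite /bethe (@det_bethe_swap _ _ _ _ _ i j)//.
    by rewrite /= ji -[nat_of_ord i]/(val i) i0.
  by rewrite !ffunE eqxx -Xj; case: eqP => // ->.
rewrite /= nuE eqxx /bethe -(@det_bethe_exclusion _ _ _ _ _ _ i j)//.
- by move=> a n; exact: entry_rec.
- by rewrite lt0n.
Qed.

Lemma is_cderive_backward_solution (s : state N) t :
  is_cderive t (backward_solution s)
    (\sum_(i < N) (backward_solution (jump s i) t - backward_solution s t)).
Proof.
have [s21|s21] := eqVneq (val s).2 (word21 N).
  have -> : backward_solution s = bethe r x (val s).1.
    by apply/funext => u; rewrite /backward_solution s21 eqxx.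
  under eq_bigr do rewrite backward_solution_jump//.
  exact: is_cderive_bethe.
have -> : backward_solution s = fun=> 0.
  by apply/funext => u; rewrite /backward_solution (negbTE s21).
rewrite big1 => [|i _]; first exact: is_cderive_cst.
by rewrite /backward_solution (negbTE (jump_word_neq i s21)) subrr.
Qed.

Lemma backward_solution_init (s : state N) : backward_solution s 0 =
  (((val s).2 == word21 N) && ((val s).1 (Ordinal hN) == x))%:R.
Proof.
rewrite /backward_solution; case: eqP => //= _; apply: bethe_init => // i j.
exact: state_lt.
Qed.

(** The geometric growth that delimits the uniqueness class; a jump moves at most one coordinate by
    one and so costs at most a factor [r^-1]. *)
Definition weight (s : state N) : R := \prod_(i < N) r^-1 ^+ `|(val s).1 i|%N.

Lemma weight_ge0 s : 0 <= weight s.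
Proof. by apply: prodr_ge0 => i _; rewrite exprn_ge0// invr_ge0 ltW. Qed.

Lemma weight_jump s i : weight (jump s i) <= r^-1 * weight s.
Proof.
rewrite {1}/weight.
have q1 : 1 <= r^-1 by rewrite invf_ge1// ltW.
have q0 : 0 <= r^-1 by apply: le_trans q1.
have [-> |->] : (val (jump s i)).1 = (val s).1 \/ (val (jump s i)).1 = advance (val s).1 i.
- rewrite /jump SubK /raw_jump; case: (val s) => X nu /=.
  by case: pickP => [j _|_]; [left; case: ifP|right].
- by rewrite ler_peMl ?weight_ge0.
rewrite (bigD1 i)//= /weight [in leRHS](bigD1 i)//= mulrA.
rewrite (eq_bigr (fun k => r^-1 ^+ `|(val s).1 k|%N)) => [|k /negbTE ki]; last first.
  by rewrite ffunE ki.
apply: ler_wpM2r; first by apply: prodr_ge0 => k _; rewrite exprn_ge0.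
by rewrite ffunE eqxx -exprS ler_weXn2l//; lia.
Qed.

Lemma backward_solution_bound (T : R) : 0 <= T -> exists2 D : R, 0 <= D &
  forall s (t : R), 0 <= t <= T -> `|backward_solution s t| <= (D * weight s)%:C.
Proof.
move=> T0; have [D D0 DP] := bethe_bound r0 r1 N x T0.
exists D => // s t /andP[t0 tT]; rewrite /backward_solution; case: ifP => _.
  by apply: DP; rewrite ger0_norm.
by rewrite normr0 ler0c mulr_ge0// weight_ge0.
Qed.

(** Uniqueness is applied twice: to the probability minus the real part of the solution, and to the
    imaginary part, both starting from 0. *)
Lemma hit_backward_solution (p : R -> state N -> state N -> R) (s : state N) (t : R) :
  is_transition_function (@tasep_rate R N) p -> 0 <= t ->
  (hit p [set s' : state N | (val s').2 = word21 N /\ (val s').1 (Ordinal hN) = x] s t)%:C =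
  backward_solution s t.
Proof.
move=> pP t0; set E := [set s' | _].
have [D D0 DP] := backward_solution_bound t0.
have q1 : 1 <= r^-1 by rewrite invf_ge1// ltW.
(* The 1 accounts for the probability, the other summand for the determinant. *)
pose W s' := 1 + D * weight s'.
have WJ s' i : W (jump s' i) <= r^-1 * W s'.
  rewrite /W mulrDr mulr1 lerD// mulrCA ler_wpM2l//; exact: weight_jump.
have tt : 0 <= t <= t by rewrite t0 lexx.
have uC s' (u : R) : {for u, continuous (fun u => complex.Re (backward_solution s' u))} /\
    {for u, continuous (fun u => complex.Im (backward_solution s' u))}.
  have [d1 d2] := is_cderive_backward_solution s' u.
  by split; apply: differentiable_continuous; apply/derivable1_diffP; exact: ex_derive.
have init s' : backward_solution s' 0 = (s' \in E)%:R.
  rewrite backward_solution_init; congr ((_ : bool)%:R).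
  by apply/andP/idP => [[/eqP a /eqP b]|/set_mem[-> ->]]; rewrite ?mem_set.
apply: complex_ext => /=.
  apply/eqP; rewrite -subr_eq0; apply/eqP.
  apply: (@linear_system_unique R _ N (@jump N) W r^-1 t
    (fun s u => hit p E s u - complex.Re (backward_solution s u)) _ WJ _ _ _ _ s t tt).
  - by rewrite invr_ge0 ltW.
  - move=> s' u ut; have u0 : 0 <= u by case/andP: ut.
    apply: le_trans (ler_normB _ _) _; apply: lerD; last exact/ler_Re_norm/DP.
    by rewrite ger0_norm ?(hit_ge0 pP)// (hit_le1 pP).
  - by move=> s'; rewrite (hit0 pP) init; case: (_ \in _); rewrite subrr.
  - move=> s' u; apply: cvgB; first exact: (hit_within pP).
    by apply: continuous_subspaceT => v; have [] := uC s' v.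
  - move=> s' u /andP[u0 _].
    have [d1 _] := is_cderive_backward_solution s' u.
    have := is_deriveB (hit_is_derive pP E s' u0) d1; congr is_derive.
    rewrite /hit_rate (big_morph (@complex.Re R) cReD (erefl : complex.Re 0 = 0)) -sumrB.
    by apply: eq_bigr => i _; rewrite cReD cReN; ring.
apply/esym.
apply: (@linear_system_unique R _ N (@jump N) W r^-1 t
  (fun s u => complex.Im (backward_solution s u)) _ WJ _ _ _ _ s t tt).
- by rewrite invr_ge0 ltW.
- move=> s' u ut; apply: le_trans (ler_Im_norm (DP _ _ ut)) _.
  by rewrite /W lerDr.
- by move=> s'; rewrite init; case: (_ \in _).
- by move=> s'; apply: continuous_subspaceT => v; have [] := uC s' v.
- move=> s' u _; have [_ d2] := is_cderive_backward_solution s' u.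
  congr is_derive: d2.
  rewrite (big_morph (@complex.Im R) cImD (erefl : complex.Im 0 = 0)).
  by apply: eq_bigr => i _; rewrite cImD cImN.
Qed.

End solution.
End word21.

Theorem theorem1p2 (R : realType) (d : measure_display) (T : measurableType d)
    (P : probability T R) (N : nat) (hN : (0 < N)%N)
    (Y : {ffun 'I_N -> int}) (hY : forall i j : 'I_N, (i < j)%N -> Y i < Y j)
    (Z : R -> T -> state N) (hZ : is_tasep P Y (word21 N) Z)
    (x : int) (t : R) (ht : 0 <= t) (r : R) (hr0 : 0 < r) (hr1 : r < 1) :
  (fine (P [set w | (val (Z t w)).2 = word21 N /\
                    (val (Z t w)).1 (Ordinal hN) = x]))%:C =
  (1 / (2 * pi%:C * (0 +i* 1))) ^+ N *
  iter_circle_integral r (fun xi : N.-tuple R[i] =>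
    (1 - tnth xi (Ordinal hN)) *
    (\prod_(i < N) \prod_(j < N | (i < j)%N)
       ((tnth xi j - tnth xi i) / (1 - tnth xi i))) *
    (\prod_(i < N) (1 / (1 - tnth xi i))) *
    (\prod_(i < N) (tnth xi i ^ (x - Y i - 1) *
                    cexp (epsilon (tnth xi i) * t%:C)))).
Proof.
have [p [pP ZP Z0]] := hZ.
have sP : is_state (Y, word21 N).
  apply/andP; split.
    by apply/forallP => i; apply/forallP => j; apply/implyP => /hY.
  by apply/forallP => i; rewrite ffunE; case: ifP.
pose s0 : state N := Sub (Y, word21 N) sP.
have Zs0 : P [set w | Z 0 w = s0] = 1%E.
  rewrite -Z0; congr (P _); apply/seteqP; split => w /=; first by move=> ->; rewrite SubK.
  by move=> H; apply: val_inj; rewrite SubK; exact: H.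
rewrite iter_circle_integral_bethe//.
(* The right side is by now the determinant at [Y]; the left side becomes [hit] from [s0], which
   uniqueness identifies with it. *)
rewrite (probability_hit pP ZP Zs0
  [set s : state N | (val s).2 = word21 N /\ (val s).1 (Ordinal hN) = x] ht).
rewrite (hit_backward_solution hN x hr0 hr1 s0 pP ht).
by rewrite /backward_solution /s0 SubK eqxx.
Qed.
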